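(* Let $k$ be an algebraically closed field, $R=k[x_0,x_1,x_2]$, $r\geq2$, $\lambda=[d_1,\dots,d_r]$ with $d_1\geq\cdots\geq d_r\geq1$, $d=\sum d_i$, $N=\binom{d+2}{2}-1$. Let $s=d_2+\cdots+d_r$ and $p=\sum_{2\leq i<j\leq r}d_id_j$ (so $p=0$ if $r=2$). Then the secant line variety $\sigma_2(\mathbb{X}_{2,\lambda})$ is defective if and only if $d_1\geq s$ and $2p-3s>0$.
   Context: $\mathbb{X}_{2,\lambda}\subset\mathbb{P}^N=\mathbb{P}(R_d)$ is the variety of classes $[F]$ of forms $F=F_1\cdots F_r$ with $F_i\in R_{d_i}$. $\sigma_2(\mathbb{X})$ is the Zariski closure of the union of lines joining two distinct points of $\mathbb{X}$; its expected dimension is $\min\{N,2\dim\mathbb{X}+1\}$, and it is defective if its actual dimension is smaller than the expected dimension. *)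

(* Defs.v *)
From HB Require Import structures.
From mathcomp Require Import all_boot all_order all_algebra.
From mathcomp Require Import mpoly.
Set Implicit Arguments. Unset Strict Implicit. Unset Printing Implicit Defensive.
Import GRing.Theory.
Local Open Scope ring_scope.

(* Forms in R = k[x_0,x_1,x_2] are elements of {mpoly k[3]}; the degree-e part
   R_e is the set of e-homogeneous polynomials.  Projective subvarieties of
   P(R_d) are handled through their affine cones in R_d, whose coordinates are
   the coefficients p@_m at monomials m. *)

Section Secant.
Variable k : closedFieldType.
Local Notation R := {mpoly k[3]}.

Definition alg_indep_on (S : R -> Prop) (ms : seq 'X_{1..3}) : Prop :=
  forall P : {mpoly k[size ms]}, P != 0 ->
    exists2 F, S F & P.@[fun i : 'I_(size ms) => F@_(nth 0%MM ms i)] != 0.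

(* The Zariski closure of S (a subset of the affine space R_d) has dimension n
   (= transcendence degree of its function field = maximal number of
   coordinate functions algebraically independent on it). *)
Definition has_dim (S : R -> Prop) (n : nat) : Prop :=
  (exists2 ms, size ms = n & alg_indep_on S ms) /\
  (forall ms, alg_indep_on S ms -> (size ms <= n)%N).

Definition Xcone (lam : seq nat) (F : R) : Prop :=
  exists Fs : seq R, [/\ size Fs = size lam,
    forall i, (i < size lam)%N -> nth 0 Fs i \is (nth 0%N lam i).-homog
    & F = \prod_(f <- Fs) f].

(* Affine cone over the union of the lines joining two distinct points of X:
   the span of F, G for F, G in the cone, linearly independent. *)
Definition sec2cone (lam : seq nat) (H : R) : Prop :=
  exists F G a b, [/\ Xcone lam F, Xcone lam G,
    (forall u v : k, u *: F + v *: G = 0 -> u = 0 /\ v = 0)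
    & H = a *: F + b *: G].

(* sigma_2(X) is defective: its dimension is smaller than
   min {N, 2 dim X + 1}; in terms of affine cones (dimension + 1):
   dim sigma_2-cone < min {N + 1, 2 dim X-cone}. *)
Definition sec2_defective (lam : seq nat) : Prop :=
  exists dX dS, [/\ has_dim (Xcone lam) dX, has_dim (sec2cone lam) dS &
    (dS < minn 'C(sumn lam + 2, 2) (2 * dX))%N].

End Secant.

Definition pairsum (t : seq nat) : nat :=
  \sum_(i < size t) \sum_(j < size t | (i < j)%N) nth 0%N t i * nth 0%N t j.

(* Main.v *)
(** Let [T_F] be the space of the forms [sum_i H_i prod_(j != i) F_j], tangent at
    [F = F_1 ... F_r] to the cone over X.  Looking at the lowest order term in [t]
    of [P(F + t V)] shows that [dim (T_F + T_G)] bounds the dimension of the cone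
    over the secant variety from below, in every characteristic and for every
    choice of [F] and [G], however special.

    If a line divides [F_i] and [G_i], the forms of [T_F + T_G] restrict to that
    line in a space of dimension [min (d + 1, 2 d_i + 2)], and those vanishing on
    it contain the tangent spaces for the type with [d_i] lowered by one.
    Lowering always the largest part, one obtains the expected rank by induction,
    except when [d_1 >= s] and [2 p > 3 s], and for fifteen sporadic types where
    suitable [F] and [G] are exhibited.

    If [d_1 >= s], the secant variety consists of the [F_1 A + G_1 B] with [A], [B]
    of degree [s]; since [(F_1, G_1)] only matters modulo [(C B, - C A)], these form
    a family of dimension at most [binomial (d + 2) 2 - (2 p - 3 s)]. *)

Require Import Defs.
From HB Require Import structures.
From Stdlib Require Import ZArith Classical.
From mathcomp Require Import all_boot all_order all_algebra.
From mathcomp Require Import mpoly ring ssrZ zify.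
Set Implicit Arguments. Unset Strict Implicit. Unset Printing Implicit Defensive.
Import GRing.Theory.
Local Open Scope ring_scope.

(** * Polynomial curves in the space of forms *)

(** The criterion comes from two differences. Put q = d_2^2 + ... + d_r^2, so that s^2 = q + 2 p. If
    d_1 >= s, the choice of C of degree d_1 - s saves binomial (d_1 - s + 2) 2 >= 1 parameters on
    twice the dimension of the cone over X, and the remaining count differs from binomial (d + 2) 2
    by exactly 2 p - 3 s. The count is thus below both expected values as soon as 2 p > 3 s.
    Genericity is handled without a topology: a condition known for special forms is carried along a
    segment towards forms that satisfy a second condition, and two nonzero polynomials in one
    parameter have a common nonroot. This is needed even for the final bound, because the special F
    and G that realise a rank may have proportional products, whereas the secant cone asks for
    independent ones. The characteristic is arbitrary, so the elimination for the sporadic types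
    uses only pivots that are units of Z[t]/(t^3 - t - 1); their images are nonzero in every
    field. *)

Section PolynomialCurves.
Variable k : closedFieldType.

Definition polyfun (f : k -> k) := exists p : {poly k}, forall t, f t = p.[t].

Lemma polyfun_sum (I : Type) (s : seq I) (P : pred I) (f : I -> k -> k) :
  (forall i, polyfun (f i)) -> polyfun (fun t => \sum_(i <- s | P i) f i t).
Proof.
move=> fP; elim: s => [|i s [p pP]].
  by exists 0 => t; rewrite big_nil horner0.
have [q qP] := fP i; exists (if P i then q + p else p) => t.
by rewrite big_cons pP; case: ifP => // _; rewrite hornerD -qP.
Qed.

Lemma polyfun_prod (I : Type) (s : seq I) (P : pred I) (f : I -> k -> k) :
  (forall i, polyfun (f i)) -> polyfun (fun t => \prod_(i <- s | P i) f i t).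
Proof.
move=> fP; elim: s => [|i s [p pP]].
  by exists 1 => t; rewrite big_nil hornerC.
have [q qP] := fP i; exists (if P i then q * p else p) => t.
by rewrite big_cons pP; case: ifP => // _; rewrite hornerM -qP.
Qed.

Lemma polyfunM (f g : k -> k) :
  polyfun f -> polyfun g -> polyfun (fun t => f t * g t).
Proof. by case=> p pP [q qP]; exists (p * q) => t; rewrite hornerM -pP -qP. Qed.

Lemma polyfunB (f g : k -> k) :
  polyfun f -> polyfun g -> polyfun (fun t => f t - g t).
Proof.
by case=> p pP [q qP]; exists (p - q) => t; rewrite hornerD hornerN -pP -qP.
Qed.

Lemma polyfun_det n (M : k -> 'M[k]_n) :
  (forall i j, polyfun (fun t => M t i j)) -> polyfun (fun t => \det (M t)).
Proof.
move=> MP; apply: polyfun_sum => s; apply: polyfunM.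
  by exists ((-1) ^+ (perm.odd_perm s))%:P => t; rewrite hornerC.
by apply: polyfun_prod.
Qed.

(** Every genericity argument rests on this: two open conditions on the affine line, each met at
    some point of its own, are met together, because an algebraically closed field is infinite. *)
Lemma polyfun_common_nonroot (f g : k -> k) a b : polyfun f -> polyfun g ->
  f a != 0 -> g b != 0 -> exists t, f t != 0 /\ g t != 0.
Proof.
case=> p pP [q qP] fa gb.
have pq0 : p * q != 0.
  by rewrite mulf_neq0 //; [apply: contraNneq fa | apply: contraNneq gb] => h0;
    rewrite ?pP ?qP h0 horner0.
have /closed_nonrootP[t] := pq0; rewrite rootE hornerM mulf_eq0 negb_or.
by rewrite -pP -qP => /andP[]; exists t.
Qed.

Variable n : nat.
Local Notation A := {mpoly k[n]}.

Definition mpolycurve (f : k -> A) :=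
  exists Q : {poly A}, forall t, f t = Q.[t%:MP].

Lemma mpolycurve_coef (f : k -> A) m :
  mpolycurve f -> polyfun (fun t => (f t)@_m).
Proof.
case=> Q QP; exists (\poly_(i < size Q) Q`_i@_m) => t.
rewrite QP horner_coef horner_poly raddf_sum /=.
by apply: eq_bigr => i _; rewrite -rmorphXn /= mulrC mcoeffCM mulrC.
Qed.

Lemma mpolycurve_cst p : mpolycurve (fun=> p).
Proof. by exists p%:P => t; rewrite hornerC. Qed.

Lemma mpolycurve_affine p q : mpolycurve (fun t => p + t *: q).
Proof.
by exists (p%:P + q%:P * 'X) => t; rewrite hornerD hornerMX !hornerC mulrC mul_mpolyC.
Qed.

Lemma mpolycurveD f g :
  mpolycurve f -> mpolycurve g -> mpolycurve (fun t => f t + g t).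
Proof. by case=> p pP [q qP]; exists (p + q) => t; rewrite hornerD -pP -qP. Qed.

Lemma mpolycurveM f g :
  mpolycurve f -> mpolycurve g -> mpolycurve (fun t => f t * g t).
Proof. by case=> p pP [q qP]; exists (p * q) => t; rewrite hornerM -pP -qP. Qed.

Lemma mpolycurve_sum (I : Type) (s : seq I) (P : pred I) (f : I -> k -> A) :
  (forall i, mpolycurve (f i)) -> mpolycurve (fun t => \sum_(i <- s | P i) f i t).
Proof.
move=> fP; elim: s => [|i s [p pP]].
  by exists 0 => t; rewrite big_nil horner0.
have [q qP] := fP i; exists (if P i then q + p else p) => t.
by rewrite big_cons pP; case: ifP => // _; rewrite hornerD -qP.
Qed.

Lemma mpolycurve_prod (I : Type) (s : seq I) (P : pred I) (f : I -> k -> A) :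
  (forall i, mpolycurve (f i)) -> mpolycurve (fun t => \prod_(i <- s | P i) f i t).
Proof.
move=> fP; elim: s => [|i s [p pP]].
  by exists 1 => t; rewrite big_nil hornerC.
have [q qP] := fP i; exists (if P i then q * p else p) => t.
by rewrite big_cons pP; case: ifP => // _; rewrite hornerM -qP.
Qed.

Lemma horner_taylor2 (R : comNzRingType) (p : {poly R}) :
  exists q : {poly R}, forall t, p.[t] = p`_0 + t * (p`_1 + t * q.[t]).
Proof.
exists (drop_poly 2 p) => t.
rewrite -{1}(poly_take_drop 2 p) hornerD hornerM hornerXn.
rewrite [take_poly 2 p]/take_poly horner_poly big_ord_recl big_ord1 /=.
by rewrite expr0 expr1 mulr1; ring.
Qed.

Lemma mpolycurve_taylor2 (f : k -> A) (Q : {poly A}) m :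
  (forall t, f t = Q.[t%:MP]) ->
  exists2 h, polyfun h &
    forall t, (f t)@_m = Q`_0@_m + t * (Q`_1@_m + t * h t).
Proof.
move=> fP; have [q qP] := horner_taylor2 Q.
exists (fun t => (q.[t%:MP])@_m); first by apply: mpolycurve_coef; exists q.
by move=> t; rewrite fP qP !(mcoeffD, mcoeffCM).
Qed.

End PolynomialCurves.

Section Tangent.
Variables (I : finType) (A : comNzRingType).

(** The differential at [F] of the multiplication of factors, in the direction [H]. *)
Definition tang (F H : I -> A) : A := \sum_i H i * \prod_(j | j != i) F j.

Lemma coef_prod_affine (F H : I -> A) :
  let Q := \prod_i ((F i)%:P + (H i)%:P * 'X) in
  Q`_0 = \prod_i F i /\ Q`_1 = tang F H.
Proof.
have c0 s : (\prod_(i <- s) ((F i)%:P + (H i)%:P * 'X))`_0 = \prod_(i <- s) F i.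
  rewrite -horner_coef0 horner_prod; apply: eq_bigr => i _.
  by rewrite hornerD hornerM !hornerC hornerX mulr0 addr0.
split; first exact: c0.
(* Over a list, the condition [j != i] removes a single factor only if there are no repetitions. *)
suff gen s : uniq s -> (\prod_(i <- s) ((F i)%:P + (H i)%:P * 'X))`_1 =
   \sum_(i <- s) H i * \prod_(j <- s | j != i) F j.
  by rewrite gen ?index_enum_uniq.
elim: s => [|i s IHs] /=; first by rewrite !big_nil coefC.
case/andP=> iNs us; rewrite big_cons mulrDl coefD coefCM IHs //.
rewrite -mulrA coefCM -commr_polyX coefMX /= c0 !big_cons eqxx /= addrC mulr_sumr.
congr (H i * _ + _).
  rewrite big_seq [RHS]big_seq_cond; apply: eq_bigl => j.
  by case: (boolP (j \in s)) => //= js; apply/esym; apply: contraNneq iNs => <-.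
rewrite big_seq [RHS]big_seq; apply: eq_bigr => j js.
have nij : i != j by apply: contraNneq iNs => ->.
by rewrite big_cons nij; ring.
Qed.

End Tangent.

(** * Nonvanishing of polynomials at points and along curves *)

Lemma digits_bound D n (f : nat -> nat) : (forall i, (i < n)%N -> (f i < D)%N) ->
  (\sum_(i < n) f i * D ^ i < D ^ n)%N.
Proof.
elim: n => [|n IHn] fD; first by rewrite big_ord0.
rewrite big_ord_recr /= expnS.
have lt_s := IHn (fun i ni => fD i (ltnW ni)).
apply: leq_trans (leq_mul (fD n (ltnSn n)) (leqnn (D ^ n))).
by rewrite mulSn ltn_add2r.
Qed.

Lemma digits_inj D n (f g : nat -> nat) :
  (forall i, (i < n)%N -> (f i < D)%N /\ (g i < D)%N) ->
  (\sum_(i < n) f i * D ^ i = \sum_(i < n) g i * D ^ i)%N ->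
  forall i, (i < n)%N -> f i = g i.
Proof.
elim: n => [|n IHn] // fgD.
have fD := digits_bound (fun i (ni : (i < n)%N) => (fgD i (ltnW ni)).1).
have gD := digits_bound (fun i (ni : (i < n)%N) => (fgD i (ltnW ni)).2).
rewrite !big_ord_recr /= => eq_fg.
have D0 : (0 < D ^ n)%N by case: (D ^ n)%N fD.
have eq_n : f n = g n.
  have := congr1 (divn^~ (D ^ n)%N) eq_fg.
  by rewrite ![(_ + _ * D ^ n)%N]addnC /= !divnMDl // !divn_small // !addn0.
move: eq_fg; rewrite eq_n => /addIn eq_fg i.
rewrite ltnS leq_eqVlt => /orP[/eqP->//|]; apply: IHn => // j jn.
exact: fgD (ltnW jn).
Qed.

Section LowestTerm.
Variable k : closedFieldType.

(* Kronecker substitution: the monomials of P stay distinct under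
   x_i := t ^ (D ^ i) when D exceeds all exponents. *)
Lemma mpoly_nonroot n (P : {mpoly k[n]}) : P != 0 -> exists v, P.@[v] != 0.
Proof.
move=> P0; pose D := msize P.
pose w (m : 'X_{1..n}) := (\sum_(i < n) m i * D ^ i)%N.
have mD (m : 'X_{1..n}) i : m \in msupp P -> (m i < D)%N.
  move/msize_mdeg_lt; apply: leq_ltn_trans.
  by rewrite mdegE (bigD1 i) //= leq_addr.
have w_inj : {in msupp P &, injective w}.
  move=> m m' mP m'P eq_w; apply/mnmP => i.
  pose c (u : 'X_{1..n}) j := if insub j is Some j' then u j' else 0%N.
  have cE u (j : 'I_n) : c u j = u j by rewrite /c valK.
  rewrite -!cE; apply: (@digits_inj D n) => //.
    by move=> j jn; rewrite (cE _ (Ordinal jn)) (cE m' (Ordinal jn)) !mD.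
  have wE u : (\sum_(j < n) c u j * D ^ j)%N = w u.
    by apply: eq_bigr => j _; rewrite cE.
  by rewrite !wE.
pose q : {poly k} := \sum_(m <- msupp P) P@_m *: 'X^(w m).
have qE t : q.[t] = P.@[fun i => t ^+ (D ^ i)].
  rewrite mevalE /q horner_sum; apply: eq_bigr => m _.
  rewrite hornerZ hornerXn /w expr_sum; congr (_ * _).
  by apply: eq_bigr => i _; rewrite -exprM mulnC.
have q0 : q != 0.
  apply/eqP => /(congr1 (fun p : {poly k} => p`_(w (mlead P)))).
  rewrite coef_sum coef0 (bigD1_seq (mlead P)) ?mlead_supp ?msupp_uniq //=.
  rewrite coefZ coefXn eqxx mulr1 big_seq_cond big1 ?addr0.
    by apply/eqP; rewrite mleadc_eq0.
  move=> m /andP[mP nm]; rewrite coefZ coefXn.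
  by rewrite (inj_in_eq w_inj) ?mlead_supp // eq_sym (negbTE nm) mulr0.
have /closed_nonrootP[t] := q0; rewrite rootE qE => tP.
by exists (fun i => t ^+ (D ^ i)).
Qed.

(** Translation by [y] is a bijection on points, so it cannot turn a polynomial with a nonroot into
    0. It moves the base point to the origin, where lowest terms are read off. *)
Lemma meval_shift_neq0 n (P : {mpoly k[n]}) (y : 'I_n -> k) : P != 0 ->
  exists2 Q : {mpoly k[n]}, Q != 0 & forall v, Q.@[v] = P.@[fun i => y i + v i].
Proof.
move=> P0; pose s := [tuple (y i)%:MP + 'X_i : {mpoly k[n]} | i < n].
have sP v : (P \mPo s).@[v] = P.@[fun i => y i + v i].
  rewrite comp_mpoly_meval; apply: meval_eq => i.
  by rewrite tnth_mktuple mevalD mevalC mevalXU.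
exists (P \mPo s) => //; have [v vP] := mpoly_nonroot P0.
apply: contra_neq vP => Ps0; have := sP (fun i => v i - y i).
by rewrite Ps0 meval0 => ->; apply: meval_eq => i; rewrite addrC subrK.
Qed.

(* Along the curves t |-> y + t (w + t h(t)) the polynomial P takes the value
   t ^ m * (P_m(w) + O(t)), where P_m is the lowest homogeneous component of P
   at y; it suffices to choose w with P_m(w) <> 0. *)
Lemma nonvanishing_direction n (P : {mpoly k[n]}) (y : 'I_n -> k) : P != 0 ->
  exists w : 'I_n -> k, forall h : 'I_n -> k -> k, (forall i, polyfun (h i)) ->
  exists g, [/\ polyfun g, g 0 != 0 &
    forall t, t != 0 -> g t != 0 ->
      P.@[fun i => y i + t * (w i + t * h i t)] != 0].
Proof.
move=> P0; have [Q Q0 QP] := meval_shift_neq0 y P0.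
have [m0 m0Q m0_min] : exists2 m0, m0 \in msupp Q &
    forall m, m \in msupp Q -> (mdeg m0 <= mdeg m)%N.
  have ex_d : exists d, has (fun m => mdeg m == d) (msupp Q).
    by exists (mdeg (mlead Q)); apply/hasP; exists (mlead Q); rewrite ?mlead_supp.
  case: (ex_minnP ex_d) => d /hasP[m0 m0Q /eqP<-] dmin; exists m0 => // m mQ.
  by apply: dmin; apply/hasP; exists m.
pose L : {mpoly k[n]} := pihomog mdeg (mdeg m0) Q.
have LE v : L.@[v] = \sum_(m <- msupp Q) Q@_m * (mdeg m == mdeg m0)%:R * \prod_i v i ^+ m i.
  rewrite /L pihomogE raddf_sum /= big_mkcond /=; apply: eq_bigr => m _.
  by rewrite mevalZ mevalX; case: eqP => _; rewrite ?mulr1 ?mulr0 ?mul0r.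
have L0 : L != 0.
  apply/eqP => /(congr1 (mcoeff m0)); rewrite /L pihomogE raddf_sum /= mcoeff0.
  rewrite big_mkcond (bigD1_seq m0) ?msupp_uniq //= eqxx mcoeffZ mcoeffX eqxx.
  rewrite mulr1 big1 ?addr0; first by apply/eqP; rewrite -mcoeff_msupp.
  by move=> m nm; case: ifP => // _; rewrite mcoeffZ mcoeffX (negbTE nm) mulr0.
have [w wL] := mpoly_nonroot L0; exists w => h hP.
pose u t i := w i + t * h i t.
exists (fun t => \sum_(m <- msupp Q)
   Q@_m * t ^+ (mdeg m - mdeg m0) * \prod_i u t i ^+ m i); split.
- apply: polyfun_sum => m; apply: polyfunM.
    by exists (Q@_m *: 'X^(mdeg m - mdeg m0)) => t; rewrite hornerZ hornerXn.
  apply: polyfun_prod => i; have [q qP] := hP i.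
  exists (((w i)%:P + 'X * q) ^+ m i) => t.
  by rewrite horner_exp hornerD hornerM hornerX hornerC /u qP.
- rewrite (_ : \sum_(m <- _) _ = L.@[w]) // LE.
  rewrite big_seq [RHS]big_seq; apply: eq_bigr => m mQ; congr (_ * _ * _).
    have := m0_min m mQ; rewrite expr0n subn_eq0 eqn_leq => ->.
    by rewrite andbT.
  by apply: eq_bigr => i _; rewrite /u mul0r addr0.
move=> t t0; set g := \sum_(m <- _) _ => g0.
have -> : P.@[fun i => y i + t * u t i] = t ^+ mdeg m0 * g.
  rewrite -QP mevalE /g mulr_sumr big_seq [RHS]big_seq; apply: eq_bigr => m mQ.
  rewrite mulrA [_ * (Q@_m * _)]mulrCA -exprD subnKC ?m0_min // -mulrA.
  congr (_ * _); rewrite mdegE expr_sum -big_split /=; apply: eq_bigr => i _.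
  by rewrite exprMn.
by rewrite mulf_neq0 // expf_neq0.
Qed.

End LowestTerm.

(** * Dimension from below: tangent spaces *)

Section TangentRank.
Variable k : closedFieldType.
Local Notation R := {mpoly k[3]}.
Local Notation mon := 'X_{1..3}.

(** Row [a] of [M] is a tangent vector at [y], restricted to the coordinates in [s]. Since [M] is
    invertible, the velocity can be made equal to the direction in which the lowest term of [P] at
    [y] does not vanish. The point [y] itself may lie outside [S]: the curve only has to be in [S]
    where [g] is nonzero. *)
Lemma alg_indep_tangent (S : R -> Prop) (s : seq mon)
    (y : 'I_(size s) -> k) (M : 'M[k]_(size s)) : \det M != 0 ->
  (forall v : 'I_(size s) -> k, exists h g b,
    [/\ forall c, polyfun (h c), polyfun g, g b != 0 &
     forall t, g t != 0 -> exists2 p, S p & forall c : 'I_(size s),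
       p@_(nth 0%MM s c) = y c + t * (\sum_a v a * M a c + t * h c t)]) ->
  alg_indep_on S s.
Proof.
move=> M0 curve P P0; have [w wP] := nonvanishing_direction y P0.
have [h [g [b [hP gP gb Sg]]]] := curve (fun a => (\row_c w c *m invmx M) 0 a).
have [g0 [g0P g00 Pg0]] := wP h hP.
have id_fun : polyfun (fun t : k => t) by exists 'X => t; rewrite hornerX.
have [t1 [t1n0 gt1]] := polyfun_common_nonroot id_fun gP (oner_neq0 _) gb.
have t1g : t1 * g t1 != 0 by rewrite mulf_neq0.
have [t [g0t]] := polyfun_common_nonroot g0P (polyfunM id_fun gP) g00 t1g.
rewrite mulf_eq0 negb_or => /andP[t0 gt]; have [p Sp pE] := Sg t gt.
exists p => //; have := Pg0 t t0 g0t; congr (_ != 0); apply: meval_eq => c.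
rewrite pE; congr (_ + _ * (_ + _)).
have : (\row_c w c *m invmx M *m M) 0 c = w c.
  by rewrite mulmxKV ?unitmxE ?unitfE // mxE.
by rewrite mxE.
Qed.

(* The space whose rank is measured is T_F + T_G if b holds, and T_F otherwise. *)
Definition tangent_rank (b : bool) (I : finType) (lam : I -> nat) (n : nat) :=
  exists (F G : I -> R) (H K : nat -> I -> R) (ms : nat -> mon),
  [/\ forall i, F i \is (lam i).-homog /\ G i \is (lam i).-homog,
      forall a i, H a i \is (lam i).-homog /\ K a i \is (lam i).-homog &
      \det (\matrix_(a < n, c < n)
        (tang F (H a) + b%:R *: tang G (K a))@_(ms c)) != 0].

Lemma tang_sum (I J : finType) (F : I -> R) (v : J -> k) (H : J -> I -> R) :
  tang F (fun i => \sum_a v a *: H a i) = \sum_a v a *: tang F (H a).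
Proof.
transitivity (\sum_i \sum_a v a *: (H a i * \prod_(j | j != i) F j)).
  by apply: eq_bigr => i _; rewrite mulr_suml; apply: eq_bigr => a _; rewrite scalerAl.
by rewrite exchange_big; apply: eq_bigr => a _; rewrite scaler_sumr.
Qed.

Lemma prod_affine_taylor (I : finType) (F V : I -> R) m :
  exists2 h, polyfun h & forall t : k,
    (\prod_i (F i + t *: V i))@_m =
      (\prod_i F i)@_m + t * ((tang F V)@_m + t * h t).
Proof.
have [Q0 Q1] := coef_prod_affine F V.
have [|h hP hE] := @mpolycurve_taylor2 k 3 (fun t => \prod_i (F i + t *: V i))
    (\prod_i ((F i)%:P + (V i)%:P * 'X)) m.
  move=> t; rewrite horner_prod; apply: eq_bigr => i _.
  by rewrite hornerD hornerM !hornerC hornerX mulrC mul_mpolyC.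
by exists h => // t; rewrite hE Q0 Q1.
Qed.

Lemma mpolycurve_tang (I : finType) (F : k -> I -> R) (H : I -> R) :
  (forall i, mpolycurve (F^~ i)) -> mpolycurve (fun t => tang (F t) H).
Proof.
move=> FP; apply: mpolycurve_sum => i; apply: mpolycurveM.
  exact: mpolycurve_cst.
by apply: mpolycurve_prod.
Qed.

Lemma mpolycurveZ (c : k) (f : k -> R) :
  mpolycurve f -> mpolycurve (fun t => c *: f t).
Proof.
by move=> fP; have [Q QP] := mpolycurveM (mpolycurve_cst c%:MP) fP;
  exists Q => t; rewrite -QP mul_mpolyC.
Qed.

(** Joins the given factors, at parameter 0, to explicit powers of a variable, at parameter 1; a
    condition known at either end then holds at some common parameter. *)
Definition segment (I : finType) (F0 F1 : I -> R) (t : k) i :=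
  F0 i + t *: (F1 i - F0 i).

Lemma segment0 (I : finType) (F0 F1 : I -> R) : segment F0 F1 0 =1 F0.
Proof. by move=> i; rewrite /segment scale0r addr0. Qed.

Lemma segment1 (I : finType) (F0 F1 : I -> R) : segment F0 F1 1 =1 F1.
Proof. by move=> i; rewrite /segment scale1r addrC subrK. Qed.

Lemma segment_homog (I : finType) (F0 F1 : I -> R) (lam : I -> nat) t :
  (forall i, F0 i \is (lam i).-homog) -> (forall i, F1 i \is (lam i).-homog) ->
  forall i, segment F0 F1 t i \is (lam i).-homog.
Proof. by move=> F0h F1h i; rewrite rpredD ?rpredZ ?rpredB. Qed.

Lemma eq_tang (I : finType) (F F' H : I -> R) : F =1 F' -> tang F H = tang F' H.
Proof.
by move=> eqF; apply: eq_bigr => i _; congr (_ * _); apply: eq_bigr.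
Qed.

Lemma homogXn (i : 'I_3) l : ('X_i : R) ^+ l \is l.-homog.
Proof. by rewrite -[X in X.-homog]mul1n dhomogMn // dhomogX /= mdeg1. Qed.

(** The passage from ranks to dimensions. The factors are deformed towards powers of x and of y,
    which makes the two products independent without destroying the nonzero determinant. *)
Lemma tangent_rank_alg_indep (lam : seq nat) (b : bool) n : (0 < sumn lam)%N ->
  tangent_rank b (fun i : 'I_(size lam) => nth 0%N lam i) n ->
  exists2 s, size s = n &
    alg_indep_on (if b then @sec2cone k lam else @Xcone k lam) s.
Proof.
move=> lam0 [F [G [H [K [ms [FGh HKh det0]]]]]].
set I := 'I_(size lam) in F G H K FGh HKh det0 *.
pose d := sumn lam.
have dE : d = \sum_(i : I) nth 0%N lam i.
  by rewrite /d sumnE (big_nth 0%N) big_mkord.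
pose x : R := 'X_ord0; pose y : R := 'X_(Ordinal (isT : 1 < 3)%N).
pose mx : mon := (U_(ord0) *+ d)%MM.
pose my : mon := (U_(Ordinal (isT : 1 < 3)%N) *+ d)%MM.
pose Ft := segment F (fun i => x ^+ nth 0%N lam i).
pose Gt := segment G (fun i => y ^+ nth 0%N lam i).
have curveF i : mpolycurve (Ft^~ i) by apply: mpolycurve_affine.
have curveG i : mpolycurve (Gt^~ i) by apply: mpolycurve_affine.
(* A 2 by 2 minor of the coefficients at x^d and y^d: where it is nonzero, the two products are
   linearly independent. It equals 1 for the pair (x^d, y^d). *)
pose minor (p q : R) := p@_mx * q@_my - p@_my * q@_mx.
have [t [dett mint]] : exists t, \det (\matrix_(a < n, c < n)
     (tang (Ft t) (H a) + b%:R *: tang (Gt t) (K a))@_(ms c)) != 0 /\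
     minor (\prod_i Ft t i) (\prod_i Gt t i) != 0.
  apply: (polyfun_common_nonroot (a := 0) (b := 1)).
  - apply: polyfun_det => a c.
    have [q qP] : polyfun (fun t => (tang (Ft t) (H a) + b%:R *: tang (Gt t) (K a))@_(ms c)).
      apply: mpolycurve_coef; apply: mpolycurveD; first exact: mpolycurve_tang.
      by apply: mpolycurveZ; apply: mpolycurve_tang.
    by exists q => t; rewrite mxE qP.
  - by apply: polyfunB; apply: polyfunM; apply: mpolycurve_coef; apply: mpolycurve_prod.
  - move: det0; congr (\det _ != 0); apply/matrixP => a c; rewrite !mxE.
    by rewrite (eq_tang _ (segment0 _ _)) (eq_tang _ (segment0 _ _)).
  - rewrite (eq_bigr _ (fun i _ => segment1 _ _ i)) [\prod_i Gt _ i](eq_bigr _ (fun i _ => segment1 _ _ i)).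
    rewrite !prodrXr -!dE /minor /x /y !mpolyXn !mcoeffX !eqxx.
    (* Here the degree must be positive, for otherwise x^d and y^d coincide. *)
    have -> : (my == mx) = false.
      apply/negP => /eqP /mnmP /(_ ord0); rewrite !mulmnE !mnmE /= mul1n mul0n.
      by move=> dd; move: lam0; rewrite -/d -dd.
    by rewrite mulr0 subr0 mulr1 oner_neq0.
have FtH i : Ft t i \is (nth 0%N lam i).-homog.
  by apply: (segment_homog (lam := fun i : I => nth 0%N lam i)) => j; [case: (FGh j) | apply: homogXn].
have GtH i : Gt t i \is (nth 0%N lam i).-homog.
  by apply: (segment_homog (lam := fun i : I => nth 0%N lam i)) => j; [case: (FGh j) | apply: homogXn].
have XconeP (F' : I -> R) : (forall i : I, F' i \is (nth 0%N lam i).-homog) ->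
    Xcone lam (\prod_i F' i).
  move=> F'h; exists [seq F' i | i <- enum 'I_(size lam)]; split.
  - by rewrite size_map size_enum_ord.
  - move=> i il; rewrite (nth_map (Ordinal il)) ?size_enum_ord //.
    by have := F'h (nth (Ordinal il) (enum 'I_(size lam)) i); rewrite nth_enum_ord.
  - by rewrite big_map big_enum.
pose s := mkseq ms n; exists s; first by rewrite size_mkseq.
have sz : n = size s by rewrite size_mkseq.
have sE c : (c < n)%N -> nth 0%MM s c = ms c by move=> cn; rewrite nth_mkseq.
clearbody s; subst n.
pose f0 := \prod_i Ft t i + b%:R *: \prod_i Gt t i.
apply: (@alg_indep_tangent _ _ (fun c => f0@_(nth 0%MM s c)) _ dett) => v.
pose V i := \sum_(a < size s) v a *: H a i.
pose W i := \sum_(a < size s) v a *: K a i.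
pose Fu u := \prod_i (Ft t i + u *: V i).
pose Gu u := \prod_i (Gt t i + u *: W i).
have exh (c : 'I_(size s)) : exists h, polyfun h /\ forall u, (Fu u + b%:R *: Gu u)@_(nth 0%MM s c) =
    f0@_(nth 0%MM s c) + u * ((tang (Ft t) V + b%:R *: tang (Gt t) W)@_(nth 0%MM s c) + u * h u).
  have [h hP hE] := prod_affine_taylor (Ft t) V (nth 0%MM s c).
  have [h' hP' hE'] := prod_affine_taylor (Gt t) W (nth 0%MM s c).
  exists (fun u => h u + b%:R * h' u); split.
    have [q qP] := hP; have [q' qP'] := hP'; exists (q + b%:R *: q') => u.
    by rewrite hornerD hornerZ qP qP'.
  move=> u; rewrite /f0 !(mcoeffD, mcoeffZ) hE hE'; ring.
have [h hP] := fin_all_exists exh.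
exists h, (fun u => minor (Fu u) (Gu u)), 0; split.
- by move=> c; case: (hP c).
- by apply: polyfunB; apply: polyfunM; apply: mpolycurve_coef; apply: mpolycurve_prod => i;
    apply: mpolycurve_affine.
- move: mint; congr (minor _ _ != 0); apply: eq_bigr => i _;
    by rewrite scale0r addr0.
move=> u minu; exists (Fu u + b%:R *: Gu u).
  have FuX : Xcone lam (Fu u).
    apply: XconeP => i; apply: rpredD; first exact: FtH.
    by apply/rpredZ/rpred_sum => a _; apply: rpredZ; case: (HKh a i).
  have GuX : Xcone lam (Gu u).
    apply: XconeP => i; apply: rpredD; first exact: GtH.
    by apply/rpredZ/rpred_sum => a _; apply: rpredZ; case: (HKh a i).
  case: (b) => /=; last by rewrite scale0r addr0.
  exists (Fu u), (Gu u), 1, 1; split=> //; last by rewrite !scale1r.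
  move=> a c ac0.
  have e m : a * (Fu u)@_m + c * (Gu u)@_m = 0.
    by have := congr1 (mcoeff m) ac0; rewrite mcoeffD !mcoeffZ mcoeff0.
  have ex := e mx; have ey := e my.
  suff: a * minor (Fu u) (Gu u) = 0 /\ c * minor (Fu u) (Gu u) = 0.
    by case=> /eqP + /eqP; rewrite !mulf_eq0 (negbTE minu) !orbF => /eqP-> /eqP->.
  rewrite /minor; split.
    transitivity ((a * (Fu u)@_mx + c * (Gu u)@_mx) * (Gu u)@_my -
                  (a * (Fu u)@_my + c * (Gu u)@_my) * (Gu u)@_mx); first by ring.
    by rewrite ex ey !mul0r subr0.
  transitivity ((a * (Fu u)@_my + c * (Gu u)@_my) * (Fu u)@_mx -
                (a * (Fu u)@_mx + c * (Gu u)@_mx) * (Fu u)@_my); first by ring.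
  by rewrite ex ey !mul0r subr0.
move=> c; rewrite (hP c).2; congr (_ + _ * (_ + _)).
rewrite /V /W !tang_sum scaler_sumr -big_split raddf_sum /=; apply: eq_bigr => a _.
by rewrite mxE -sE // !(mcoeffD, mcoeffZ); ring.
Qed.

End TangentRank.

(** * Induction step: one factor acquires the line z = 0 *)

Section Step.
Variable k : closedFieldType.
Local Notation R := {mpoly k[3]}.
Local Notation mon := 'X_{1..3}.
Local Notation x0 := (ord0 : 'I_3).
Local Notation x1 := (Ordinal (isT : 1 < 3)%N).
Local Notation x2 := (Ordinal (isT : 2 < 3)%N).

Definition xymon (a b : nat) : mon := (U_(x0) *+ a + U_(x1) *+ b)%MM.

Lemma mpolyX_xymon a b : 'X_[xymon a b] = 'X_x0 ^+ a * 'X_x1 ^+ b :> R.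
Proof. by rewrite /xymon mpolyXD -!mpolyXn. Qed.

Lemma xymon_inj a b a' b' : xymon a b = xymon a' b' -> a = a' /\ b = b'.
Proof.
move/mnmP => e; have := e x0; have := e x1.
by rewrite !mnmDE !mulmnE !mnm1E /= !mul0n !mul1n !addn0.
Qed.

(** Reading the coefficients at monomials in x and y is restriction to the line z = 0; this yields
    the zero block of the matrix in the induction step. *)
Lemma mcoeff_mulz_xymon (p : R) a b : ('X_x2 * p)@_(xymon a b) = 0.
Proof.
rewrite mulrC (mpolyE p) mulr_suml raddf_sum big1 // => m _ /=.
rewrite -scalerAl -mpolyXD mcoeffZ mcoeffX.
case: eqP => [/mnmP/(_ x2)|_]; last by rewrite mulr0.
by rewrite !mnmDE !mulmnE !mnm1E /= !mul0n addn1.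
Qed.

Definition at_index (I : finType) (i0 : I) (p : R) (i : I) : R :=
  if i == i0 then p else 0.

Lemma tang_at_index (I : finType) (i0 : I) (F : I -> R) p :
  tang F (at_index i0 p) = p * \prod_(j | j != i0) F j.
Proof.
rewrite /tang (bigD1 i0) //= {1}/at_index eqxx [X in _ + X]big1 ?addr0 // => i ni.
by rewrite /at_index (negbTE ni) mul0r.
Qed.

Lemma tang0 (I : finType) (F : I -> R) : tang F (fun=> 0) = 0.
Proof. by rewrite /tang big1 // => i _; rewrite mul0r. Qed.

Definition mul_at (I : finType) (i0 : I) (l : R) (F : I -> R) (i : I) : R :=
  if i == i0 then l * F i else F i.

Lemma prod_mul_at (I : finType) (i0 : I) l (F : I -> R) :
  \prod_(j | j != i0) mul_at i0 l F j = \prod_(j | j != i0) F j.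
Proof. by apply: eq_bigr => j nj; rewrite /mul_at (negbTE nj). Qed.

(** Each term of the tangent sum contains exactly one factor of index [i0], either the varied one or
    one in the product, so [l] comes out once. Hence the new tangent space contains [l] times the
    old one. *)
Lemma tang_mul_at (I : finType) (i0 : I) l (F H : I -> R) :
  tang (mul_at i0 l F) (mul_at i0 l H) = l * tang F H.
Proof.
rewrite /tang mulr_sumr; apply: eq_bigr => i _; have [-> | ni] := eqVneq i i0.
  by rewrite prod_mul_at /mul_at eqxx mulrA.
rewrite {1}/mul_at (negbTE ni) (bigD1 i0) 1?eq_sym //= [in RHS](bigD1 i0) 1?eq_sym //=.
rewrite /mul_at eqxx; set P := \prod_(_ | _) _; set P' := \prod_(_ | _) F _.
have -> : P = P' by apply: eq_bigr => j /andP[_ nj]; rewrite (negbTE nj).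
by ring.
Qed.

Lemma mul_at_homog (I : finType) (i0 : I) (l : R) (lam lam' : I -> nat) F :
  l \is 1.-homog -> lam' i0 = (lam i0).+1 ->
  (forall i, i != i0 -> lam' i = lam i) ->
  (forall i, F i \is (lam i).-homog) ->
  forall i, mul_at i0 l F i \is (lam' i).-homog.
Proof.
move=> lh e0 e Fh i; rewrite /mul_at; have [->|ni] := eqVneq i i0.
  by have := dhomogM lh (Fh i0); rewrite e0 add1n.
by rewrite e.
Qed.

(* Take F_i0 and G_i0 divisible by the line z = 0.  The multiples of z in the
   new tangent space contain z times the old one; restricted to z = 0, what is
   left is the span of A k[x,y]_(d_i0) and B k[x,y]_(d_i0) with A, B general
   binary forms, and x^e, y^e are general enough. *)
Lemma tangent_rank_step (b : bool) (I : finType) (i0 : I) (lam lam' : I -> nat) n c :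
  lam' i0 = (lam i0).+1 -> (forall i, i != i0 -> lam' i = lam i) ->
  (if b then (c <= (\sum_i lam i).+2) && (c <= 2 * (lam i0).+2)
   else (c <= (lam i0).+2))%N ->
  tangent_rank k b lam n -> tangent_rank k b lam' (n + c).
Proof.
move=> e0 e bc [F [G [H [K [ms [FGh HKh det0]]]]]].
set D := (\sum_i lam i)%N in bc *; pose e1 := (\sum_(i | i != i0) lam i)%N.
have De : D = (lam i0 + e1)%N by rewrite /D (bigD1 i0).
pose x : R := 'X_x0; pose y : R := 'X_x1; pose z : R := 'X_x2.
pose Ft := segment F (fun i => x ^+ lam i).
pose Gt := segment G (fun i => y ^+ lam i).
have curveF i : mpolycurve (Ft^~ i) by apply: mpolycurve_affine.
have curveG i : mpolycurve (Gt^~ i) by apply: mpolycurve_affine.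
pose d0 := lam' i0.
(* the j-th extra column is x^(p j) y^(D+1-p j); rows j <= d0 use A, the others B *)
pose p j := if (j <= d0)%N then (D.+1 - j)%N else (j - d0.+1)%N.
pose u j : R := 'X_[if (j <= d0)%N then xymon (d0 - j) j
                    else xymon (j - d0.+1) (d0 - (j - d0.+1))].
pose Hn j := if (j <= d0)%N then at_index i0 (u j) else fun=> 0.
pose Kn j := if (j <= d0)%N then fun=> 0 else at_index i0 (u j).
pose H' a := if (a < n)%N then mul_at i0 z (H a) else Hn (a - n)%N.
pose K' a := if (a < n)%N then mul_at i0 z (K a) else Kn (a - n)%N.
pose ms' a := if (a < n)%N then (U_(x2) + ms a)%MM
              else xymon (p (a - n)%N) (D.+1 - p (a - n)%N).
pose M1 t : 'M[k]_n := \matrix_(a, c) (tang (Ft t) (H a) + b%:R *: tang (Gt t) (K a))@_(ms c).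
pose N t j := tang (Ft t) (Hn j) + b%:R *: tang (Gt t) (Kn j).
pose M2 t : 'M[k]_c := \matrix_(j, l) (N t j)@_(xymon (p l) (D.+1 - p l)).
(* At parameter 1 the cofactors are A = x^e1 and B = y^e1, so each extra row is a single monomial
   and the block [M2 1] is the identity. *)
have N1 (j : 'I_c) : N 1 j = 'X_[xymon (p j) (D.+1 - p j)].
  have Fe : \prod_(j | j != i0) Ft 1 j = x ^+ e1.
    rewrite -prodrXr; apply: eq_bigr => i _; exact: segment1.
  have Ge : \prod_(j | j != i0) Gt 1 j = y ^+ e1.
    rewrite -prodrXr; apply: eq_bigr => i _; exact: segment1.
  rewrite /N /Hn /Kn /u /p; case: leqP => jd.
    rewrite tang_at_index tang0 scaler0 addr0 Fe !mpolyX_xymon -/x -/y.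
    rewrite mulrAC -exprD De; congr (_ ^+ _ * _ ^+ _); move: jd; rewrite /d0 e0; lia.
  have [b1 cD c2] : [/\ b, c <= D.+2 & c <= 2 * (lam i0).+2]%N.
    case: (b) bc => [/andP[]|]; first by [].
    by move: (ltn_ord j) jd; rewrite /d0 e0; lia.
  rewrite tang_at_index tang0 add0r b1 scale1r Ge !mpolyX_xymon -/x -/y.
  rewrite -mulrA -exprD De; congr (_ ^+ _ * _ ^+ _).
  by move: jd c2 cD (ltn_ord j); rewrite /d0 e0 De; lia.
(* The rows from A give the exponents of x from D + 1 - d0 to D + 1, and [c <= D + 2] keeps those
   from B at most D - d0. *)
have p_inj (j l : 'I_c) : p j = p l -> j = l.
  move=> pjl; apply: val_inj; move: pjl; rewrite /p /=.
  have d0E : d0 = (lam i0).+1 by [].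
  have [cD c2] : (c <= D.+2 /\ (b -> c <= 2 * (lam i0).+2))%N.
    by case: (b) bc => [/andP[]|]; lia.
  have [jc lc] := (ltn_ord j, ltn_ord l).
  by case: leqP => ?; case: leqP => ?; lia.
have M2_1 : M2 1 = 1%:M.
  apply/matrixP => j l; rewrite !mxE N1 mcoeffX; congr ((nat_of_bool _)%:R).
  by apply/eqP/eqP => [/xymon_inj[/p_inj->]|->].
have M1P a l : polyfun (fun t => M1 t a l).
  have [q qP] : polyfun (fun t => (tang (Ft t) (H a) + b%:R *: tang (Gt t) (K a))@_(ms l)).
    apply: mpolycurve_coef; apply: mpolycurveD; first exact: mpolycurve_tang.
    by apply: mpolycurveZ; apply: mpolycurve_tang.
  by exists q => t; rewrite mxE qP.
have M2P a l : polyfun (fun t => M2 t a l).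
  have [q qP] : polyfun (fun t => (N t a)@_(xymon (p l) (D.+1 - p l))).
    apply: mpolycurve_coef; apply: mpolycurveD; first exact: mpolycurve_tang.
    by apply: mpolycurveZ; apply: mpolycurve_tang.
  by exists q => t; rewrite mxE qP.
have [t [M1t M2t]] : exists t, \det (M1 t) != 0 /\ \det (M2 t) != 0.
  apply: (polyfun_common_nonroot (a := 0) (b := 1)); try exact: polyfun_det.
    move: det0; congr (\det _ != 0); apply/matrixP => a l; rewrite !mxE.
    by rewrite (eq_tang _ (segment0 _ _)) (eq_tang _ (segment0 _ _)).
  by rewrite M2_1 det1 oner_neq0.
have zh : z \is 1.-homog by rewrite dhomogX /= mdeg1.
have FtH i : Ft t i \is (lam i).-homog.
  by apply: segment_homog => j; [case: (FGh j) | apply: homogXn].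
have GtH i : Gt t i \is (lam i).-homog.
  by apply: segment_homog => j; [case: (FGh j) | apply: homogXn].
have uh j : (j < c)%N -> u j \is d0.-homog.
  rewrite /u dhomogX /= => jc.
  have [cD c2] : (c <= D.+2 /\ (b -> c <= 2 * (lam i0).+2))%N.
    by case: (b) bc => [/andP[]|]; lia.
  case: leqP; rewrite /xymon mdegD !mdegMn !mdeg1 !mul1n /d0 e0; first lia.
  by case: (b) bc c2 => [_ /(_ isT)|]; lia.
exists (mul_at i0 z (Ft t)), (mul_at i0 z (Gt t)).
(* Homogeneity is required for every natural [a], so the directions beyond the matrix are set to
   0. *)
exists (fun a => if (a < n + c)%N then H' a else fun=> 0).
exists (fun a => if (a < n + c)%N then K' a else fun=> 0), ms'; split.
- by move=> i; split; apply: (mul_at_homog zh e0 e).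
- move=> a i; case: ifP => anc; last by split; apply: dhomog0.
  rewrite /H' /K'; case: ltnP => an.
    by split; apply: (mul_at_homog zh e0 e) => j; case: (HKh a j).
  have ac : (a - n < c)%N by lia.
  have ath : at_index i0 (u (a - n)%N) i \is (lam' i).-homog.
    by rewrite /at_index; case: eqP => [->|_]; [apply: uh | apply: dhomog0].
  by rewrite /Hn /Kn; case: ifP => _; split=> //; apply: dhomog0.
set M := \matrix_(_, _) _.
(* The first [n] rows are multiples of z: in the columns z m they reproduce the old matrix, and in
   the columns free of z they vanish. *)
have -> : M = block_mx (M1 t) 0 (\matrix_(j, l) (N t j)@_(U_(x2) + ms l)) (M2 t).
  have rown (a : 'I_n) (m : mon) : (tang (mul_at i0 z (Ft t)) (mul_at i0 z (H a)) +
       b%:R *: tang (mul_at i0 z (Gt t)) (mul_at i0 z (K a)))@_m =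
       (z * (tang (Ft t) (H a) + b%:R *: tang (Gt t) (K a)))@_m.
    by rewrite !tang_mul_at scalerAr mulrDr.
  have rowc (j : 'I_c) : tang (mul_at i0 z (Ft t)) (Hn j) +
       b%:R *: tang (mul_at i0 z (Gt t)) (Kn j) = N t j.
    have tE p' q : tang (mul_at i0 z p') (at_index i0 q) = tang p' (at_index i0 q).
      by rewrite !tang_at_index prod_mul_at.
    by rewrite /N /Hn /Kn; case: ifP => _; rewrite !(tE, tang0).
  apply/matrixP => a l; rewrite mxE ltn_ord /H' /K' /ms'.
  case: (split_ordP a) => a' ->; case: (split_ordP l) => l' ->;
    rewrite ?(block_mxEul, block_mxEur, block_mxEdl, block_mxEdr) mxE /=
      ?ltn_ord ?[(n + _ < n)%N]ltnNge ?leq_addr /= ?addKn.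
  - by rewrite rown (mulrC z) mcoeffMX.
  - by rewrite rown mcoeff_mulz_xymon.
  - by rewrite rowc.
  - by rewrite rowc.
by rewrite det_lblock mulf_neq0.
Qed.

Lemma tangent_rank0 (b : bool) (I : finType) (lam : I -> nat) :
  (forall i, lam i = 0%N) -> (0 < #|I|)%N -> tangent_rank k b lam 1.
Proof.
move=> lam0 /card_gt0P[i0 _].
exists (fun=> 1), (fun=> 1), (fun=> at_index i0 1), (fun=> fun=> 0), (fun=> 0%MM).
split=> [i|_ i|]; first by rewrite lam0 dhomog1.
  rewrite lam0 dhomog0 /at_index; split=> //.
  by case: ifP => _; [apply: dhomog1 | apply: dhomog0].
rewrite det_mx11 mxE tang_at_index tang0 scaler0 addr0 big1 // mulr1.
by rewrite mcoeff1 eqxx oner_neq0.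
Qed.

Lemma big_codom (T : Type) (idx : T) (op : Monoid.com_law idx) (I J : finType)
    (h : J -> I) (P : pred I) (f : I -> T) : injective h ->
  (forall i, i \notin codom h -> P i -> f i = idx) ->
  \big[op/idx]_(i | P i) f i = \big[op/idx]_(j | P (h j)) f (h j).
Proof.
move=> h_inj fP; rewrite (bigID (mem (codom h))) /= [X in op _ X]big1; last first.
  by move=> i /andP[iP /fP]; apply.
rewrite Monoid.mulm1.
transitivity (\big[op/idx]_(i in h @: [set j | P (h j)]) f i).
  apply: eq_bigl => i; apply/andP/imsetP => [[iP /codomP[j ij]]|[j]].
    by exists j; rewrite // inE -ij.
  by rewrite inE => jP ->; rewrite codom_f.
by rewrite big_imset => [|? ? _ _ /h_inj//]; apply: eq_bigl => j; rewrite inE.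
Qed.

(** The added factors have degree 0: the constant 1 with zero variation changes neither a product
    nor a tangent vector. *)
Lemma tangent_rank_embed (b : bool) (I J : finType) (h : J -> I)
    (lam : I -> nat) n : injective h ->
  (forall i, i \notin codom h -> lam i = 0%N) ->
  tangent_rank k b (lam \o h) n -> tangent_rank k b lam n.
Proof.
move=> h_inj h0 [F [G [H [K [ms [FGh HKh det0]]]]]].
pose ext (c : R) (F : J -> R) i :=
  if [pick j | h j == i] is Some j then F j else c.
have extE c F' j : ext c F' (h j) = F' j.
  rewrite /ext; case: pickP => [j' /eqP/h_inj-> //|/(_ j)].
  by rewrite eqxx.
have extN c F' i : i \notin codom h -> ext c F' i = c.
  move=> ih; rewrite /ext; case: pickP => // j /eqP hj.
  by rewrite -hj codom_f in ih.
have exth c F' : c \is 0.-homog -> (forall j, F' j \is (lam (h j)).-homog) ->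
    forall i, ext c F' i \is (lam i).-homog.
  move=> ch F'h i; have [/codomP[j ->]|ih] := boolP (i \in codom h).
    by rewrite extE.
  by rewrite extN // h0.
have tangE F' H' : tang (ext 1 F') (ext 0 H') = tang F' H'.
  rewrite /tang (big_codom _ h_inj) => [|i ih _]; last by rewrite extN // mul0r.
  apply: eq_bigr => j _; rewrite extE; congr (_ * _).
  rewrite (big_codom _ h_inj) => [|i ih _]; last by rewrite extN.
  by apply: eq_big => [l|l _]; rewrite ?(inj_eq h_inj) ?extE.
exists (ext 1 F), (ext 1 G), (fun a => ext 0 (H a)), (fun a => ext 0 (K a)), ms.
split=> [i|a i|]; first by split; apply: exth => [|j]; rewrite ?dhomog1 //; case: (FGh j).
  by split; apply: exth => [|j]; rewrite ?dhomog0 //; case: (HKh a j).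
move: det0; congr (\det _ != 0); apply/matrixP => a l; rewrite !mxE.
by rewrite !tangE.
Qed.

End Step.

(** * Dimension from above: parameter counts *)

Section AlgebraicDependence.
Variables (F : fieldType) (n : nat).

Lemma mdeg_supp_prod (I : Type) (s : seq I) (f : I -> {mpoly F[n]}) (e : I -> nat) :
  (forall i m, m \in msupp (f i) -> (mdeg m <= e i)%N) ->
  forall m, m \in msupp (\prod_(i <- s) f i) -> (mdeg m <= \sum_(i <- s) e i)%N.
Proof.
move=> fe; elim: s => [|i s IHs] m.
  by rewrite !big_nil msupp1 inE => /eqP->; rewrite mdeg0.
rewrite !big_cons => /msuppM_le/allpairsP[[m1 m2] /= [/fe m1e /IHs m2e ->]].
by rewrite mdegD leq_add.
Qed.

Lemma mdeg_supp_exp (f : {mpoly F[n]}) e a :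
  (forall m, m \in msupp f -> (mdeg m <= e)%N) ->
  forall m, m \in msupp (f ^+ a) -> (mdeg m <= a * e)%N.
Proof.
move=> fe m; have -> : f ^+ a = \prod_(i < a) f by rewrite prodr_const card_ord.
by move/(@mdeg_supp_prod _ _ (fun=> f) (fun=> e)); rewrite sum_nat_const card_ord; apply.
Qed.

(* For large D there are more monomials with exponents < D in N > n variables
   than coefficients in their images under x_i := f_i, which have degree O(D). *)
Lemma mpoly_alg_dependent N (f : N.-tuple {mpoly F[n]}) : (n < N)%N ->
  exists2 P : {mpoly F[N]}, P != 0 & P \mPo f = 0.
Proof.
move=> nN; pose e := (\max_i msize (tnth f i))%N.
have fe i m : m \in msupp (tnth f i) -> (mdeg m <= e)%N.
  by move/msize_mdeg_lt/ltnW/leq_trans; apply; apply: (leq_bigmax i).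
(* [B] exceeds the degree of every image of a monomial with exponents below [D]. As B <= (N e + 1) D
   and (N e + 1)^n < D, one gets B^n < D^(n+1) <= D^N. *)
pose D := ((N * e).+1 ^ n).+1; pose B := (N * (D * e)).+1.
have lt_BD : (B ^ n < D ^ N)%N.
  apply: (@leq_trans (D ^ n.+1)); last by rewrite leq_pexp2l.
  apply: (@leq_ltn_trans (((N * e).+1 * D) ^ n)).
    case: (n) => [|n'] //; rewrite leq_exp2r // /B; move: (D) (isT : 0 < D)%N; nia.
  by rewrite expnMn expnS ltn_mul2r expn_gt0 /=.
pose img (a : {ffun 'I_N -> 'I_D}) := \prod_i tnth f i ^+ a i.
pose M := \matrix_(i < #|{ffun 'I_N -> 'I_D}|, j < #|{ffun 'I_n -> 'I_B}|)
  (img (enum_val i))@_[multinom (enum_val j l : nat) | l < n].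
have ker0 : kermx M != 0.
  rewrite -mxrank_eq0 mxrank_ker subn_eq0 -ltnNge.
  apply: leq_ltn_trans (rank_leq_col _) _.
  by rewrite !card_ffun !card_ord.
have [u /sub_kermxP uM u0] := rowV0Pn ker0.
pose mon (a : {ffun 'I_N -> 'I_D}) := [multinom (a i : nat) | i < N].
have mon_inj : injective mon.
  move=> a a' /mnmP eq_a; apply/ffunP => i; apply: val_inj.
  by have := eq_a i; rewrite !mnmE.
exists (\sum_i u 0 i *: 'X_[mon (enum_val i)]).
  have [i ui] : exists i, u 0 i != 0.
    by have /rV0Pn := u0.
  apply/eqP => /(congr1 (mcoeff (mon (enum_val i)))).
  rewrite mcoeff0 raddf_sum (bigD1 i) //= mcoeffZ mcoeffX eqxx mulr1 big1 ?addr0.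
    exact/eqP.
  move=> j ji; rewrite mcoeffZ mcoeffX (inj_eq mon_inj) (inj_eq enum_val_inj).
  by rewrite (negbTE ji) mulr0.
have imgE a : 'X_[mon a] \mPo f = img a.
  by rewrite comp_mpolyX; apply: eq_bigr => i _; rewrite mnmE.
have -> : (\sum_i u 0 i *: 'X_[mon (enum_val i)]) \mPo f =
    \sum_i u 0 i *: img (enum_val i).
  by rewrite raddf_sum; apply: eq_bigr => i _ /=; rewrite comp_mpolyZ imgE.
apply/mpolyP => m; rewrite mcoeff0 raddf_sum /=.
have [mB|mB] := boolP [forall l, m l < B]%N.
  pose b := [ffun l => Ordinal (forallP mB l)].
  have := congr1 (fun A : 'rV__ => A 0 (enum_rank b)) uM; rewrite !mxE => uMb.
  rewrite -[RHS]uMb; apply: eq_bigr => i _; rewrite mcoeffZ mxE; congr (_ * _@_ _).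
  by apply/mnmP => l; rewrite mnmE enum_rankK ffunE.
have [l ml] := forallPn mB.
rewrite big1 // => i _; rewrite mcoeffZ [_@_m]memN_msupp_eq0 ?mulr0 //.
apply: contra ml => mi; rewrite ltnS.
apply: leq_trans (_ : mdeg m <= _)%N; first by rewrite mdegE (bigD1 l) //= leq_addr.
have : (mdeg m <= \sum_(i0 < N) D * e)%N; last by rewrite sum_nat_const card_ord.
apply: mdeg_supp_prod mi => j m'; move/(mdeg_supp_exp (@fe j)) => m'e.
by apply: leq_trans m'e _; rewrite leq_mul2r ltnW ?orbT.
Qed.

End AlgebraicDependence.

(** * Families of forms depending polynomially on named parameters *)

Section PolynomialFunctions.
Variables (k : comNzRingType) (T : eqType) (ks : seq T).

(** The parameters are the values of an assignment [v] at the keys in [ks], so that counting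
    parameters amounts to computing the size of a list. *)
Definition polyfun_on (f : (T -> k) -> k) := exists q : {mpoly k[size ks]},
  forall v, f v = q.@[fun i => v (tnth (in_tuple ks) i)].

Definition mpolyfun_on n (f : (T -> k) -> {mpoly k[n]}) :=
  forall m, polyfun_on (fun v => (f v)@_m).

Lemma polyfun_on_cst c : polyfun_on (fun=> c).
Proof. by exists c%:MP => v; rewrite mevalC. Qed.

Lemma polyfun_on_var x : x \in ks -> polyfun_on (fun v => v x).
Proof.
move=> xks; have ix : (index x ks < size ks)%N by rewrite index_mem.
exists 'X_(Ordinal ix) => v; rewrite mevalXU.
by rewrite (tnth_nth x) nth_index.
Qed.

Lemma polyfun_onM f g :
  polyfun_on f -> polyfun_on g -> polyfun_on (fun v => f v * g v).
Proof. by case=> p pP [q qP]; exists (p * q) => v; rewrite mevalM pP qP. Qed.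

Lemma polyfun_on_sum (I : Type) (s : seq I) (P : pred I) (f : I -> (T -> k) -> k) :
  (forall i, polyfun_on (f i)) -> polyfun_on (fun v => \sum_(i <- s | P i) f i v).
Proof.
move=> fP; elim: s => [|i s [p pP]].
  by exists 0 => v; rewrite big_nil meval0.
have [q qP] := fP i; exists (if P i then q + p else p) => v.
by rewrite big_cons pP qP; case: ifP => // _; rewrite mevalD.
Qed.

Variable n : nat.
Implicit Types f g : (T -> k) -> {mpoly k[n]}.

Lemma mpolyfun_on_cst p : mpolyfun_on (fun=> p : {mpoly k[n]}).
Proof. by move=> m; apply: polyfun_on_cst. Qed.

Lemma mpolyfun_onD f g :
  mpolyfun_on f -> mpolyfun_on g -> mpolyfun_on (fun v => f v + g v).
Proof.
by move=> fP gP m; have [p pP] := fP m; have [q qP] := gP m;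
  exists (p + q) => v; rewrite mcoeffD pP qP mevalD.
Qed.

Lemma mpolyfun_onM f g :
  mpolyfun_on f -> mpolyfun_on g -> mpolyfun_on (fun v => f v * g v).
Proof.
move=> fP gP m.
have [q qP] : polyfun_on (fun v => \sum_(l : 'X_{1..n < (mdeg m).+1, (mdeg m).+1} |
    m == (l.1 + l.2)%MM) ((f v)@_l.1 * (g v)@_l.2)).
  by apply: polyfun_on_sum => l; apply: polyfun_onM; [apply: fP | apply: gP].
by exists q => v; rewrite mcoeffM qP.
Qed.

Lemma mpolyfun_on_prod (I : Type) (s : seq I) (f : I -> (T -> k) -> {mpoly k[n]}) :
  (forall i, mpolyfun_on (f i)) -> mpolyfun_on (fun v => \prod_(i <- s) f i v).
Proof.
move=> fP; elim: s => [|i s IHs] m.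
  by have [q qP] := @mpolyfun_on_cst 1 m; exists q => v; rewrite big_nil -(qP v).
have [q qP] := mpolyfun_onM (fP i) IHs m.
by exists q => v; rewrite big_cons qP.
Qed.

Lemma mpolyfun_on_form (s : seq 'X_{1..n}) (key : 'X_{1..n} -> T) :
  {in s, forall m, key m \in ks} ->
  mpolyfun_on (fun v => \sum_(m <- s) v (key m) *: 'X_[m]).
Proof.
move=> sks m.
have [q qP] : polyfun_on (fun v => \sum_(l <- s)
    (* The closure lemma for sums asks for a polynomial function at every index, and [key l] is
       known to be a parameter only for [l] in [s]. *)
    (if l \in s then v (key l) * ('X_[l] : {mpoly k[n]})@_m else 0)).
  apply: polyfun_on_sum => l; case: (boolP (l \in s)) => ls; last exact: polyfun_on_cst.
  by apply: polyfun_onM; [apply: polyfun_on_var; apply: sks | apply: polyfun_on_cst].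
exists q => v; rewrite -(qP v) raddf_sum big_seq [RHS]big_seq /=.
by apply: eq_bigr => l ls; rewrite ls mcoeffZ.
Qed.

End PolynomialFunctions.

(** If finitely many families with at most [n] parameters cover [S], more than [n] coordinates
    satisfy an algebraic relation on each family; the product of these relations vanishes on all of
    [S]. *)
Lemma size_alg_indep_on (k : closedFieldType) (S : {mpoly k[3]} -> Prop)
    (J : finType) (good : pred J) (T : eqType) (ks : J -> seq T)
    (phi : J -> (T -> k) -> {mpoly k[3]}) n :
  (forall j, good j -> (size (ks j) <= n)%N /\ mpolyfun_on (ks j) (phi j)) ->
  (forall H, S H -> exists j v, good j /\ H = phi j v) ->
  forall ms, alg_indep_on S ms -> (size ms <= n)%N.
Proof.
move=> phiP cover ms indep; rewrite leqNgt; apply/negP => lt_n.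
have exP j : exists P : {mpoly k[size ms]}, P != 0 /\
    (good j -> forall v, P.@[fun i => (phi j v)@_(nth 0%MM ms i)] = 0).
  case: (boolP (good j)) => gj; last first.
    by exists 1; rewrite oner_neq0.
  have [szj phij] := phiP j gj.
  have [f fE] := fin_all_exists (fun i : 'I_(size ms) => phij (nth 0%MM ms i)).
  have [P P0 Pf] := mpoly_alg_dependent [tuple f i | i < size ms] (leq_ltn_trans szj lt_n).
  exists P; split=> // _ v.
  have := congr1 (meval (fun i => v (tnth (in_tuple (ks j)) i))) Pf.
  rewrite comp_mpoly_meval meval0 => <-; apply: meval_eq => i.
  by rewrite fE tnth_mktuple.
have [P PP] := fin_all_exists exP.
have P0 : \prod_j P j != 0 by apply/prodf_neq0 => j _; case: (PP j).
have [H SH] := indep _ P0.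
have [j [v [gj ->]]] := cover H SH.
by rewrite rmorph_prod (bigD1 j) //= (PP j).2 // mul0r eqxx.
Qed.

(** * Parameter counts for X and for its secant variety *)

Section UpperBounds.
Variable k : closedFieldType.
Local Notation R := {mpoly k[3]}.
Local Notation mon := 'X_{1..3}.

Definition monos d : seq mon := [seq s2m (val t) | t <- enum (basis 3 d)].

Lemma mem_monos d m : (m \in monos d) = (mdeg m == d).
Proof. by rewrite basis_cover. Qed.

Lemma uniq_monos d : uniq (monos d).
Proof. exact: uniq_basis. Qed.

Lemma size_monos d : size (monos d) = 'C(d + 2, 2).
Proof. by rewrite size_basis addn2 -addn2 -(bin_sub (leq_addr 2 d)) addKn. Qed.

Definition form_of (s : seq mon) (c : mon -> k) : R := \sum_(m <- s) c m *: 'X_[m].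

Lemma form_of_coef (s : seq mon) (p : R) : uniq s ->
  (forall m, m \notin s -> p@_m = 0) -> p = form_of s (fun m => p@_m).
Proof.
move=> us ps; apply/mpolyP => m; rewrite raddf_sum /=.
have [ms|nms] := boolP (m \in s); last first.
  rewrite ps // big1_seq // => l /andP[_ ls]; rewrite mcoeffZ mcoeffX.
  by have [lm|_] := eqVneq l m; [rewrite -lm ls in nms | rewrite mulr0].
rewrite (bigD1_seq m) //= mcoeffZ mcoeffX eqxx mulr1 big1 ?addr0 // => l lm.
by rewrite mcoeffZ mcoeffX (negbTE lm) mulr0.
Qed.

Lemma homog_form_of d (p : R) : p \is d.-homog -> p = form_of (monos d) (fun m => p@_m).
Proof.
move=> ph; apply: form_of_coef; first exact: uniq_monos.
by move=> m; rewrite mem_monos => md; apply: (dhomog_nemf_coeff ph).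
Qed.

(** The normalised coefficient saves one parameter per factor. Monomials above [m0] keep free
    coefficients, since only the number of parameters matters. *)
Definition monic_form d m0 c : R := 'X_[m0] + form_of (rem m0 (monos d)) c.

Lemma homog_monic_form d (p : R) : p \is d.-homog -> mleadc p = 1 ->
  p = monic_form d (mlead p) (fun m => p@_m).
Proof.
move=> ph p1; have p0 : p != 0 by rewrite -mleadc_eq0 p1 oner_neq0.
have pd : mlead p \in monos d.
  by rewrite mem_monos; apply/eqP/(dhomog_mf ph)/mlead_supp.
rewrite {1}(homog_form_of ph) /form_of (perm_big _ (perm_to_rem pd)) big_cons /=.
by rewrite p1 scale1r.
Qed.

Section Cone.
Variables (d1 : nat) (ds : seq nat).
Local Notation I := 'I_(size ds).
Local Notation deg := (fun i : I => nth 0%N ds i).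

Lemma Xcone_monic F : Xcone (d1 :: ds) F -> exists (F1 : R) (Q : I -> R),
  [/\ F1 \is d1.-homog, forall i, Q i \is (deg i).-homog /\ mleadc (Q i) = 1 &
      F = F1 * \prod_i Q i].
Proof.
case=> [[|F1 Fs] []] //= [sFs] FsH ->; rewrite big_cons.
have F1h := FsH 0%N isT.
have Fsh (i : I) : nth 0 Fs i \is (deg i).-homog by apply: (FsH i.+1); rewrite ltnS.
rewrite (big_nth 0) sFs big_mkord.
have [F0|nz] := eqVneq (\prod_(i < size ds) nth 0 Fs i) 0.
  (* If some later factor is 0, the whole product is 0; the zero is moved into the first factor and
     the others become arbitrary monic forms. *)
  exists 0, (fun i => 'X_ord0 ^+ deg i); split; rewrite ?F0 ?mulr0 ?mul0r ?dhomog0 //.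
  by move=> i; split; [apply: homogXn | rewrite mpolyXn mleadXm mcoeffX eqxx].
pose c i := mleadc (nth 0 Fs i).
have Fsn (i : I) : nth 0 Fs i != 0.
  by apply: contraNneq nz => F0; apply/eqP; rewrite (bigD1 i) //= F0 mul0r.
have cn (i : I) : c i != 0 by rewrite mleadc_eq0.
exists ((\prod_(i : I) c i) *: F1), (fun i => (c i)^-1 *: nth 0 Fs i); split.
- by rewrite rpredZ.
- by move=> i; split; [apply/rpredZ/Fsh | rewrite mleadcZE mulVf ?cn].
rewrite scaler_prod -scalerAl -scalerAr scalerA prodfV mulfV ?scale1r //.
by apply/prodf_neq0.
Qed.

(** The choices of leading monomials index the families of the cover. Bounding the degrees makes
    this a finite type. *)
Definition leads := {ffun I -> 'X_{1..3 < (sumn ds).+1}}.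
Definition good_leads (j : leads) := [forall i, (j i : mon) \in monos (deg i)].

Lemma leadsP (Q : I -> R) : (forall i, Q i \is (deg i).-homog /\ mleadc (Q i) = 1) ->
  exists2 j : leads, good_leads j & forall i, j i = mlead (Q i) :> mon.
Proof.
move=> QP.
have Qd i : mlead (Q i) \in monos (deg i).
  have [Qh Q1] := QP i; rewrite mem_monos; apply/eqP/(dhomog_mf Qh)/mlead_supp.
  by rewrite -mleadc_eq0 Q1 oner_neq0.
have lt_d i : (mdeg (mlead (Q i)) < (sumn ds).+1)%N.
  have := Qd i; rewrite mem_monos ltnS => /eqP->.
  by rewrite sumnE (big_nth 0%N) big_mkord (bigD1 i) //= leq_addr.
exists [ffun i => BMultinom (lt_d i)]; last by move=> i; rewrite ffunE.
by apply/forallP => i; rewrite ffunE; apply: Qd.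
Qed.

(** The tag [key i] separates the coefficients of different factors; the secant count uses two such
    blocks with disjoint tags. *)
Definition monic_keys (key : nat -> nat) (j : leads) : seq (nat * mon) :=
  flatten [seq [seq (key i, m) | m <- rem (j i : mon) (monos (deg i))]
           | i : 'I_(size ds) <- enum 'I_(size ds)].

Definition monic_prod (key : nat -> nat) (j : leads) (v : nat * mon -> k) : R :=
  \prod_(i : I) monic_form (deg i) (j i) (fun m => v (key i, m)).

Lemma size_monic_keys key j : good_leads j ->
  size (monic_keys key j) = (\sum_(i : I) 'C(deg i + 2, 2).-1)%N.
Proof.
move=> /forallP gj; rewrite size_flatten /shape -map_comp sumnE big_map big_enum /=.
by apply: eq_bigr => i _; rewrite size_map size_rem // size_monos.
Qed.

Lemma mpolyfun_on_sub (ks ks' : seq (nat * mon)) (f : (nat * mon -> k) -> R) :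
  {subset ks <= ks'} -> mpolyfun_on ks f -> mpolyfun_on ks' f.
Proof.
move=> sub fP m; have [q qP] := fP m.
have ix (i : 'I_(size ks)) : (index (tnth (in_tuple ks) i) ks' < size ks')%N.
  by rewrite index_mem sub // mem_tnth.
exists (q \mPo [tuple 'X_(Ordinal (ix i)) | i < size ks]) => v.
rewrite comp_mpoly_meval qP; apply: meval_eq => i.
rewrite tnth_mktuple mevalXU; congr v.
by rewrite [RHS](tnth_nth (0%N, 0%MM)) nth_index // sub // mem_tnth.
Qed.

Lemma mpolyfun_on_monic_prod key j :
  mpolyfun_on (monic_keys key j) (monic_prod key j).
Proof.
apply: mpolyfun_on_prod => i; apply: mpolyfun_onD; first exact: mpolyfun_on_cst.
apply: (@mpolyfun_on_form _ _ _ _ _ (fun m => (key i, m))) => m mi.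
apply/flattenP; exists [seq (key i, m) | m <- rem (j i : mon) (monos (deg i))].
  by apply/mapP; exists i; rewrite ?mem_enum.
exact: map_f.
Qed.

(** Only the first factor carries a scalar; the others are monic and contribute one parameter less
    than their number of coefficients. *)
Lemma Xcone_dim_le ms : alg_indep_on (@Xcone k (d1 :: ds)) ms ->
  (size ms <= 'C(d1 + 2, 2) + \sum_(i : I) 'C(deg i + 2, 2).-1)%N.
Proof.
pose ks (j : leads) := [seq (0%N, m) | m <- monos d1] ++ monic_keys succn j.
pose phi (j : leads) (v : nat * mon -> k) :=
  form_of (monos d1) (fun m => v (0%N, m)) * monic_prod succn j v.
apply: (@size_alg_indep_on _ _ _ good_leads _ ks phi) => [j gj|F].
  split.
    by rewrite size_cat size_map size_monos size_monic_keys.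
  apply: mpolyfun_onM.
    apply: (@mpolyfun_on_form _ _ _ _ _ (fun m => (0%N, m))) => m md1.
    by rewrite mem_cat map_f.
  apply: mpolyfun_on_sub (mpolyfun_on_monic_prod succn j) => x xj.
  by rewrite mem_cat xj orbT.
case/Xcone_monic => F1 [Q [F1h QP ->]]; have [j gj jE] := leadsP QP.
pose v (x : nat * mon) := if x.1 is i.+1 then
  (if insub i is Some i' then (Q i')@_x.2 else 0) else F1@_x.2.
exists j, v; split=> //; congr (_ * _); first exact: homog_form_of.
apply: eq_bigr => i _; have [Qh Q1] := QP i.
rewrite {1}(homog_monic_form Qh Q1) jE /monic_form; congr (_ + _).
by apply: eq_bigr => m _; rewrite /v /= valK.
Qed.

(* Division by B: the multiples C * B are determined by their coefficients at
   the monomials divisible by the leading one. *)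
Lemma homog_reduce s (B P : R) : B != 0 -> B \is s.-homog -> (s <= d1)%N ->
  P \is d1.-homog -> exists2 C : R, C \is (d1 - s).-homog &
    forall m, (mlead B <= m)%MM -> (P - C * B)@_m = 0.
Proof.
move=> B0 Bh sd Ph; set M := mlead B.
have Ms : mdeg M = s by apply: (dhomog_mf Bh); apply: mlead_supp.
pose N := size (monos (d1 - s)); pose mu (i : 'I_N) := nth 0%MM (monos (d1 - s)) i.
pose A := \matrix_(i < N, l < N) ('X_[mu i] * B)@_(M + mu l).
have formA (u : 'rV_N) l : (u *m A) 0 l = ((\sum_i u 0 i *: 'X_[mu i]) * B)@_(M + mu l).
  rewrite mulr_suml raddf_sum mxE; apply: eq_bigr => i _.
  by rewrite mxE -scalerAl /= mcoeffZ.
have mu_inj : injective mu.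
  by move=> i j /eqP; rewrite nth_uniq ?uniq_monos // => /eqP/val_inj.
have Cmon (u : 'rV_N) i : (\sum_i u 0 i *: 'X_[mu i] : R)@_(mu i) = u 0 i.
  rewrite raddf_sum (bigD1 i) //= mcoeffZ mcoeffX eqxx mulr1 big1 ?addr0 // => j ji.
  by rewrite mcoeffZ mcoeffX (inj_eq mu_inj) (negbTE ji) mulr0.
have Ch (u : 'rV_N) : (\sum_i u 0 i *: 'X_[mu i] : R) \is (d1 - s).-homog.
  by apply: rpred_sum => i _; apply: rpredZ; rewrite dhomogX -mem_monos mem_nth.
have muP m : mdeg m = (d1 - s)%N -> exists i, m = mu i.
  move=> md; have mi : m \in monos (d1 - s) by rewrite mem_monos md.
  by exists (Ordinal (etrans (index_mem _ _) mi)); rewrite /mu nth_index.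
(* For a nonzero C in the kernel, the leading monomial of C B is [M + mlead C], which is one of the
   positions read by [A], although its coefficient is not 0. *)
have Aunit : A \in unitmx.
  rewrite -row_free_unit -kermx_eq0; apply/rowV0P => u /sub_kermxP uA.
  apply/eqP; apply: contraT => u0.
  have C0 : (\sum_i u 0 i *: 'X_[mu i] : R) != 0.
    apply: contraNneq u0 => C0; apply/eqP/rowP => i.
    by rewrite -Cmon C0 mcoeff0 mxE.
  have [i Ei] := muP _ (dhomog_mf (Ch u) (mlead_supp C0)).
  have := formA u i; rewrite uA mxE -Ei addmC -mleadM // => /esym/eqP.
  by rewrite mleadc_eq0 mulf_eq0 (negbTE C0) (negbTE B0).
pose u := (\row_l P@_(M + mu l)) *m invmx A.
exists (\sum_i u 0 i *: 'X_[mu i]) => // m Mm.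
have [md|md] := eqVneq (mdeg m) d1; last first.
  apply: (@dhomog_nemf_coeff _ _ mdeg d1) => //; apply: rpredB => //.
  by have := dhomogM (Ch u) Bh; rewrite subnK.
have [i Ei] : exists i, (m - M)%MM = mu i.
  apply: muP; apply: (@addIn s); rewrite -{1}Ms -mdegD submK // md subnK //.
have -> : m = (M + mu i)%MM by rewrite -Ei addmC submK.
by rewrite mcoeffB -formA /u mulmxKV // mxE subrr.
Qed.

(** The multiples of [M] correspond to the monomials of degree [d1 - mdeg M]; their number is what
    the secant variety loses. *)
Lemma size_monos_ndiv (M : mon) : (mdeg M <= d1)%N ->
  size [seq m <- monos d1 | ~~ (M <= m)%MM] = ('C(d1 + 2, 2) - 'C(d1 - mdeg M + 2, 2))%N.
Proof.
move=> Md; rewrite -!size_monos size_filter.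
rewrite -(count_predC (fun m => M <= m)%MM (monos d1)).
suff -> : count (fun m => M <= m)%MM (monos d1) = size (monos (d1 - mdeg M)) by rewrite addKn.
rewrite -size_filter -[RHS](size_map (fun m => (m + M)%MM)); apply/perm_size/uniq_perm.
- by rewrite filter_uniq ?uniq_monos.
- by rewrite map_inj_uniq ?uniq_monos //; apply: addIm.
move=> m; rewrite mem_filter mem_monos; apply/andP/mapP => [[Mm /eqP md]|[l + ->]].
  exists (m - M)%MM; last by rewrite submK.
  by rewrite mem_monos -md -[X in (mdeg X - _)%N](submK Mm) mdegD addnK.
by rewrite mem_monos => /eqP ld; rewrite lem_addl mdegD ld subnK.
Qed.

(* F_1 A + G_1 B with A and B monic; the pairs (F_1, G_1) are taken modulo
   (C B, - C A), so that no monomial of F_1 is divisible by the leading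
   monomial of B. *)
Lemma sec2cone_dim_le ms : (sumn ds <= d1)%N ->
  alg_indep_on (@sec2cone k (d1 :: ds)) ms ->
  (size ms <= 'C(d1 + 2, 2) - 'C(d1 - sumn ds + 2, 2) + 'C(d1 + 2, 2)
      + 2 * \sum_(i : I) 'C(deg i + 2, 2).-1)%N.
Proof.
(* Tags 0 and 1 belong to F_1 and G_1, the even tags from 2 on to the factors of A, the odd ones
   from 3 on to those of B. *)
move=> sd; pose kA i := (2 * i).+2; pose kB i := (2 * i).+3.
pose M (j : leads) : mon := (\sum_i (j i : mon))%MM.
pose nd j := [seq m <- monos d1 | ~~ (M j <= m)%MM].
pose ks (j : leads * leads) := [seq (0%N, m) | m <- nd j.2] ++ [seq (1%N, m) | m <- monos d1]
  ++ monic_keys kA j.1 ++ monic_keys kB j.2.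
pose phi (j : leads * leads) (v : nat * mon -> k) :=
  form_of (nd j.2) (fun m => v (0%N, m)) * monic_prod kA j.1 v +
  form_of (monos d1) (fun m => v (1%N, m)) * monic_prod kB j.2 v.
have sumE : (\sum_(i : I) deg i = sumn ds)%N.
  by rewrite sumnE (big_nth 0%N) big_mkord.
apply: (@size_alg_indep_on _ _ _ (fun j => good_leads j.1 && good_leads j.2) _ ks phi).
  move=> j /andP[g1 g2]; split.
    have MD : mdeg (M j.2) = sumn ds.
      rewrite mdeg_sum; apply: etrans sumE; apply: eq_bigr => i _.
      by have /forallP/(_ i) := g2; rewrite mem_monos => /eqP.
    rewrite /ks !size_cat 2!size_map !size_monic_keys // size_monos_ndiv ?MD //.
    by rewrite size_monos mul2n -addnn !addnA.
  apply: mpolyfun_onD; apply: mpolyfun_onM.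
  - apply: (@mpolyfun_on_form _ _ _ _ _ (fun m => (0%N, m))) => m md1.
    by rewrite mem_cat map_f.
  - apply: mpolyfun_on_sub (mpolyfun_on_monic_prod kA j.1) => x xj.
    by rewrite !mem_cat xj !orbT.
  - apply: (@mpolyfun_on_form _ _ _ _ _ (fun m => (1%N, m))) => m md1.
    by rewrite !mem_cat [_ \in [seq (1%N, _) | _ <- _]]map_f ?orbT.
  - apply: mpolyfun_on_sub (mpolyfun_on_monic_prod kB j.2) => x xj.
    by rewrite !mem_cat xj !orbT.
move=> H [F [G [a [b [/Xcone_monic[F1 [A [F1h AP ->]]] /Xcone_monic[G1 [B [G1h BP ->]]] _ ->]]]]].
have [jA gA jAE] := leadsP AP; have [jB gB jBE] := leadsP BP.
have nz (Q : I -> R) : (forall i, Q i \is (deg i).-homog /\ mleadc (Q i) = 1) ->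
    forall i, Q i != 0.
  by move=> QP i; rewrite -mleadc_eq0 (QP i).2 oner_neq0.
have ph (Q : I -> R) : (forall i, Q i \is (deg i).-homog /\ mleadc (Q i) = 1) ->
    \prod_i Q i \is (sumn ds).-homog.
  move=> QP; rewrite -sumE; elim/big_rec2: _ => [|i x y _ yx]; first exact: dhomog1.
  by apply: dhomogM => //; case: (QP i).
have B0 : \prod_i B i != 0 by apply/prodf_neq0 => i _; apply: nz.
have [C Ch CP] := homog_reduce B0 (ph _ BP) sd (rpredZ a F1h).
(* The scalars [a] and [b] are absorbed, and the added terms cancel: - C B A + C A B = 0. *)
pose F1' := a *: F1 - C * \prod_i B i.
pose G1' := b *: G1 + C * \prod_i A i.
have F1'h : F1' \is d1.-homog.
  by apply: rpredB; [apply: rpredZ | have := dhomogM Ch (ph _ BP); rewrite subnK].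
have G1'h : G1' \is d1.-homog.
  by apply: rpredD; [apply: rpredZ | have := dhomogM Ch (ph _ AP); rewrite subnK].
pose v (x : nat * mon) := match x.1 with
  | 0 => F1'@_x.2 | 1 => G1'@_x.2
  | i.+2 => if insub i./2 is Some i' then (if odd i then (B i')@_x.2 else (A i')@_x.2) else 0
  end.
exists (jA, jB), v; split; first by rewrite gA gB.
have -> : a *: (F1 * \prod_i A i) + b *: (G1 * \prod_i B i) =
    F1' * \prod_i A i + G1' * \prod_i B i.
  by rewrite /F1' /G1' -!mul_mpolyC; ring.
have ME : M jB = mlead (\prod_i B i).
  by rewrite mlead_prod => [|i _ _]; [apply: eq_bigr => i _ | apply: nz].
congr (_ * _ + _ * _).
- rewrite -[LHS]/F1' /phi /=; apply: form_of_coef; first by rewrite filter_uniq ?uniq_monos.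
  move=> m; rewrite mem_filter negb_and negbK ME mem_monos => /orP[|md].
    exact: CP.
  exact: (dhomog_nemf_coeff F1'h).
- apply: eq_bigr => i _; have [Qh Q1] := AP i.
  rewrite {1}(homog_monic_form Qh Q1) jAE /monic_form; congr (_ + _).
  by apply: eq_bigr => m _; rewrite /v /kA /= mul2n doubleK odd_double valK.
- exact: homog_form_of.
- apply: eq_bigr => i _; have [Qh Q1] := BP i.
  rewrite {1}(homog_monic_form Qh Q1) jBE /monic_form; congr (_ + _).
  by apply: eq_bigr => m _; rewrite /v /kB /= mul2n uphalf_double odd_double valK.
Qed.

End Cone.
End UpperBounds.

Local Close Scope ring_scope.

(** * Lowering the largest part *)

Definition sqsum (s : seq nat) := sumn [seq x * x | x <- s].

(** A factor of degree e, up to scalars, has (e^2 + 3 e) / 2 parameters, and one more is due to the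
    common scalar; the sum is doubled. *)
Definition twice_dim_cone (s : seq nat) := sqsum s + 3 * sumn s + 2.

Definition expected_rank (s : seq nat) := minn 'C(sumn s + 2, 2) (twice_dim_cone s).

(** These contain all types, with positive parts in decreasing order, for which lowering the largest
    part would lose rank; enumeration up to total degree 14 yields them. *)
Definition sporadic : seq (seq nat) :=
  [:: [:: 1; 1; 1; 1]; [:: 1; 1; 1; 1; 1]; [:: 1; 1; 1; 1; 1; 1];
      [:: 2; 1; 1; 1; 1]; [:: 2; 2; 1; 1]; [:: 2; 2; 2]; [:: 2; 2; 2; 1];
      [:: 3; 3; 1; 1]; [:: 3; 3; 2]; [:: 3; 3; 3]; [:: 4; 3; 3];
      [:: 4; 4; 1; 1]; [:: 4; 4; 2]; [:: 5; 5; 2]; [:: 6; 6; 2]].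

Lemma perm_sumn s s' : perm_eq s s' -> sumn s = sumn s'.
Proof. by rewrite !sumnE; apply: perm_big. Qed.

Lemma perm_sqsum s s' : perm_eq s s' -> sqsum s = sqsum s'.
Proof. by move=> p; apply/perm_sumn/perm_map. Qed.

Lemma sqsum_le_mul a t : all (geq a) t -> sqsum t <= a * sumn t.
Proof.
rewrite /sqsum; elim: t => //= x t IHt /andP[xa /IHt ta].
by rewrite mulnDr leq_add // leq_mul2r xa orbT.
Qed.

Lemma sqsum_le_sq t : sqsum t <= sumn t * sumn t.
Proof.
rewrite /sqsum; elim: t => //= x t IHt.
by rewrite mulnDl !mulnDr -addnA leq_add2l; apply: leq_trans IHt _; rewrite addnA leq_addl.
Qed.

(** By convexity, the sum of squares is largest when the total is concentrated in two parts, [a] and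
    the remainder. *)
Lemma sqsum_le_two a t : all (geq a) t -> a <= sumn t <= 2 * a ->
  sqsum t <= a * a + (sumn t - a) * (sumn t - a).
Proof.
have convex x y : x <= a -> y <= a -> a <= x + y ->
    x * x + y * y <= a * a + (x + y - a) * (x + y - a).
  move=> xa ya axy; have [u aE] : exists u, a = x + u by exists (a - x); lia.
  have [v yE] : exists v, y = u + v by exists (y - u); lia.
  have vx : v <= x by lia.
  rewrite yE aE (_ : x + (u + v) - (x + u) = v); last by lia.
  by have := leq_mul (leqnn u) vx; nia.
elim: t => [|x t IHt] /=; first by case: a {convex} => // _ /andP[].
move=> /andP[xa ta] /andP[a_le le_a]; rewrite -[sqsum (x :: t)]/(x * x + sqsum t).
have [a_le'|lt_a] := leqP a (sumn t); last first.
  apply: leq_trans (_ : x * x + sumn t * sumn t <= _).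
    by rewrite leq_add2l sqsum_le_sq.
  by apply: convex => //; lia.
have := IHt ta; rewrite a_le' /=; move/(_ (leq_trans (leq_addl _ _) le_a)).
have [u uE] : exists u, sumn t = a + u by exists (sumn t - a); lia.
rewrite uE (_ : a + u - a = u); last lia.
by rewrite (_ : x + (a + u) - a = x + u); [nia | lia].
Qed.

(* The largest part a can be lowered by one with no loss of rank, except when
   the sum S of the others is at least a + 2 and the space of forms of the
   smaller degree is already filled with room to spare. *)
Definition irreducible_type a S sq :=
  (a.+2 <= S) && ((a + S) * (a + S).+1 < 2 * (a.-1 * a.-1 + sq + 3 * (a.-1 + S) + 2)).

(** Write S = a + 2 + d. For d >= 2 the estimate q <= a S already leaves only small cases. For d <=
    1 it gives nothing, and the two-part estimate is used; the value 14 is attained by 6, 6, 2. *)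
Lemma irreducible_bound a t : 0 < a -> all (geq a) t ->
  irreducible_type a (sumn t) (sqsum t) -> a + sumn t <= 14.
Proof.
case: a => // a _ ta /andP[] /=; move: (sumn t) (sqsum t) (sqsum_le_mul ta)
  (sqsum_le_two ta) => S q le1 le2 aS.
have [d dE] : exists d, S = a.+1 + d.+2 by exists (S - a.+3); lia.
subst S => {aS} lt; have [d2|] := leqP d 1; last first.
  by move=> d2; nia.
have [da|] := leqP d.+2 a.+1; last by lia.
have {}le2 : q <= a.+1 * a.+1 + d.+2 * d.+2.
  by have := le2; rewrite (_ : a.+1 + d.+2 - a.+1 = d.+2) ?addKn //; apply; lia.
by case: d d2 lt le1 le2 da => [|[|]] // _; nia.
Qed.

(** [fuel] bounds the number of parts and [m] the largest one. *)
Fixpoint partitions (fuel m n : nat) : seq (seq nat) :=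
  if fuel is f.+1 then
    if n is 0 then [:: [::]]
    else flatten [seq [seq x :: s | s <- partitions f x (n - x)] | x <- iota 1 (minn m n)]
  else [:: [::]].

Lemma mem_partitions fuel m e : size e <= fuel -> all (geq m) e -> all (leq 1) e ->
  sorted geq e -> e \in partitions fuel m (sumn e).
Proof.
elim: fuel m e => [|f IHf] m [|x e] //=; rewrite ltnS => se /andP[xm em] /andP[x0 e0] exs.
case E : (x + sumn e) => [|n']; first by lia.
rewrite -E; apply/flattenP.
exists [seq x :: s | s <- partitions f x (x + sumn e - x)].
  by apply/mapP; exists x; rewrite // mem_iota x0 /= add1n ltnS leq_min xm leq_addr.
rewrite addKn map_f //; apply: IHf => //.
- by rewrite (order_path_min _ exs) // => ? ? ? /[swap]; apply: leq_trans.
- exact: path_sorted exs.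
Qed.

Lemma irreducible_sporadic e : all (leq 1) e -> sorted geq e -> sumn e <= 14 ->
  irreducible_type (head 0 e) (sumn (behead e)) (sqsum (behead e)) -> e \in sporadic.
Proof.
move=> e0 e_s e14.
have check : all (fun n => all (fun e => irreducible_type (head 0 e) (sumn (behead e))
    (sqsum (behead e)) ==> (e \in sporadic)) (partitions 14 14 n)) (iota 0 15).
  by vm_compute.
have se : size e <= sumn e by elim: (e) e0 => //= x u IHu /andP[x0 /IHu]; lia.
have em : all (geq 14) e.
  apply/allP => x xe; apply: leq_trans e14.
  by rewrite sumnE (big_rem x) //= leq_addr.
have := allP check (sumn e); rewrite mem_iota add0n ltnS e14 => /(_ isT)/allP/(_ e).
by rewrite mem_partitions ?(leq_trans se) // => /(_ isT)/implyP.
Qed.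

(** * Expected rank by induction on the degree *)

Section Induction.
Variable k : closedFieldType.

Definition secant_rank (s : seq nat) n :=
  tangent_rank k true (fun i : 'I_(size s) => nth 0 s i) n.

(** Permuting the parts and deleting zeros are both selections of distinct indices that include
    every nonzero part. *)
Lemma secant_rank_select s (Is : seq nat) n : uniq Is -> all (gtn (size s)) Is ->
  (forall i, i < size s -> i \notin Is -> nth 0 s i = 0) ->
  secant_rank [seq nth 0 s i | i <- Is] n -> secant_rank s n.
Proof.
move=> uI lI zI rk; pose Js := [seq nth 0 s i | i <- Is].
have sz : size Js = size Is by rewrite size_map.
have hP (j : 'I_(size Js)) : nth 0 Is j < size s.
  by have /allP := lI; apply; rewrite mem_nth -?sz.
pose h j := Ordinal (hP j).
have jI (j : 'I_(size Js)) : j < size Is by rewrite -sz.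
apply: (@tangent_rank_embed _ _ _ _ h) => [i j /(congr1 val) /eqP /=|i ih|].
- by rewrite nth_uniq ?jI // => /eqP/val_inj.
- apply: zI => //; apply: contra ih => iI.
  have ilt : index (i : nat) Is < size Js by rewrite sz index_mem.
  apply/codomP; exists (Ordinal ilt); apply: val_inj => /=.
  by rewrite nth_index.
case: rk => F [G [H [K [ms [FGh HKh det0]]]]].
exists F, G, H, K, ms; split=> // [i|a i]; [have := FGh i | have := HKh a i];
  by rewrite (nth_map 0) // jI.
Qed.

Lemma secant_rank_perm s s' n : perm_eq s s' -> secant_rank s n -> secant_rank s' n.
Proof.
move=> /(perm_iotaP 0)[Is pI ->]; apply: secant_rank_select.
- by rewrite (perm_uniq pI) iota_uniq.
- by apply/allP => i; rewrite (perm_mem pI) mem_iota add0n.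
- by move=> i il; rewrite (perm_mem pI) mem_iota add0n il.
Qed.

Lemma secant_rank_filter s n : secant_rank (filter (leq 1) s) n -> secant_rank s n.
Proof.
pose Is := [seq i <- iota 0 (size s) | 0 < nth 0 s i].
have -> : filter (leq 1) s = [seq nth 0 s i | i <- Is].
  by rewrite -{1}(mkseq_nth 0 s) /mkseq filter_map.
apply: secant_rank_select; first by rewrite filter_uniq ?iota_uniq.
  by apply/allP => i; rewrite mem_filter mem_iota add0n => /and3P[].
by move=> i il; rewrite mem_filter mem_iota add0n il /= andbT -eqn0Ngt => /eqP.
Qed.

Lemma secant_rank_step a t n c : c <= a + sumn t + 2 -> c <= 2 * a + 4 ->
  secant_rank (a :: t) n -> secant_rank (a.+1 :: t) (n + c).
Proof.
move=> c1 c2; apply: (@tangent_rank_step _ _ _ ord0) => //.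
- by case=> [[|i]].
have -> : \sum_(i < size (a :: t)) nth 0 (a :: t) i = a + sumn t.
  by rewrite big_ord_recl /= sumnE (big_nth 0) big_mkord.
by rewrite /= -addn2 c1; move: c2; lia.
Qed.

Hypothesis secant_rank_sporadic :
  forall e, e \in sporadic -> secant_rank e (expected_rank e).

(** Lowering a part may break the order of the list and create zeros, so the type is sorted and
    cleaned before it is looked up. *)
Lemma secant_rank_irreducible a t : 0 < a -> all (geq a) t ->
  irreducible_type a (sumn t) (sqsum t) ->
  secant_rank (a :: t) (expected_rank (a :: t)).
Proof.
move=> a0 ta irr; pose f := filter (leq 1) (a :: t); pose e := sort geq f.
have ef : perm_eq e f by rewrite perm_sort.
have geq_tr : transitive geq by move=> ? ? ? /[swap]; apply: leq_trans.
have e_s : sorted geq e by apply: sort_sorted => x y; apply: leq_total.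
have e0 : all (leq 1) e by rewrite (perm_all _ ef) filter_all.
have filter_sum (g : nat -> nat) u : g 0 = 0 ->
    sumn [seq g x | x <- filter (leq 1) u] = sumn [seq g x | x <- u].
  move=> g0; elim: u => //= x u IHu; case: ltnP => /= [_|]; first by rewrite IHu.
  by rewrite leqn0 => /eqP->; rewrite g0.
have sumE : sumn e = a + sumn t.
  by rewrite (perm_sumn ef) -[f]map_id filter_sum // map_id.
have sqE : sqsum e = a * a + sqsum t.
  by rewrite (perm_sqsum ef) /sqsum filter_sum.
have ae : a \in e by rewrite (perm_mem ef) mem_filter a0 mem_head.
have headE : head 0 e = a.
  case: e ae e_s ef {e0 sumE sqE} => // x e; rewrite inE => /orP[/eqP-> //|ae].
  move=> /(order_path_min geq_tr)/allP/(_ _ ae) /= ax /perm_mem/(_ x).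
  rewrite mem_head mem_filter inE => /esym/andP[_ /orP[/eqP //|/(allP ta) xa]].
  by apply/eqP; rewrite eqn_leq; apply/andP.
have eE : e = a :: behead e by rewrite -headE; case: (e) ae.
have e_sp : e \in sporadic.
  apply: irreducible_sporadic => //.
    by rewrite sumE irreducible_bound.
  move: sumE sqE; rewrite headE eE /sqsum /= => /addnI -> /addnI ->.
  by [].
have := secant_rank_sporadic e_sp.
rewrite /expected_rank /twice_dim_cone sumE sqE.
by move/(secant_rank_perm ef)/secant_rank_filter.
Qed.

Lemma bin2_double n : 2 * 'C(n + 2, 2) = (n + 2) * (n + 1).
Proof. by rewrite addn2 -mul_bin_diag bin1 addn1. Qed.

(** Under the hypothesis, twice the difference of the two sides is at least (a - S + 1) (a - S + 2),
    a product of consecutive integers. The two cases only avoid truncated subtraction. *)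
Lemma fill_condition a t : sumn t * sumn t <= 3 * sumn t + sqsum t ->
  'C(a + sumn t + 2, 2) <= twice_dim_cone (a :: t).
Proof.
rewrite -[twice_dim_cone _]/(a * a + sqsum t + 3 * (a + sumn t) + 2) => le_S.
rewrite -(leq_pmul2l (isT : 0 < 2)) bin2_double.
case: (leqP (sumn t) a) => [le_a|lt_S].
  have [u ->] : exists u, a = sumn t + u by exists (a - sumn t); lia.
  by nia.
have [u uE] : exists u, sumn t = a + u.+1 by exists (sumn t - a.+1); lia.
by move: le_S; rewrite uE; nia.
Qed.

(** As S^2 - q = 2 p, the second alternative says 2 p <= 3 S, so the hypothesis negates the
    criterion for defectivity. It survives the lowering of the largest part, and irreducible types
    are the only ones where the step would fall short. *)
Lemma secant_rank_expected a t : all (geq a) t ->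
  (a < sumn t) || (sumn t * sumn t <= 3 * sumn t + sqsum t) ->
  secant_rank (a :: t) (expected_rank (a :: t)).
Proof.
have [N] := ubnP (a + sumn t); elim: N a t => // N IHN [|a] t; rewrite ltnS => leN ta good.
  have t0 : forall i, nth 0 t i = 0.
    move=> i; have [it|it] := ltnP i (size t); last exact: nth_default.
    by apply/eqP; rewrite -leqn0; apply: (allP ta); apply: mem_nth.
  have sum0 : sumn t = 0.
    by rewrite sumnE (big_nth 0) big1 // => i _; rewrite t0.
  rewrite /expected_rank /twice_dim_cone /= add0n sum0 binn (minn_idPl _) ?addn2 //.
  by apply: tangent_rank0; rewrite ?card_ord // => -[[|i] ?]; rewrite /= ?t0.
have [irr|] := boolP (irreducible_type a.+1 (sumn t) (sqsum t)).
  exact: secant_rank_irreducible.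
rewrite negb_and -leqNgt -ltnNge /= => red.
set S := sumn t in leN good red *; set q := sqsum t in good red *.
have rk : secant_rank (a :: t) (minn 'C(a + S + 2, 2) (a * a + q + 3 * (a + S) + 2)).
  (* If the largest value occurs again, the lowered part is no longer the largest, and the two are
     exchanged. *)
  have [aI|aI] := boolP (a.+1 \in t).
    have pt : perm_eq t (a.+1 :: rem a.+1 t) by apply: perm_to_rem.
    pose r := rem a.+1 t.
    have SE : S = a.+1 + sumn r by rewrite /S (perm_sumn pt).
    have qE : q = a.+1 * a.+1 + sqsum r by rewrite /q (perm_sqsum pt).
    have p2 : perm_eq (a.+1 :: a :: r) (a :: t).
      by rewrite perm_sym (perm_trans (y := a :: a.+1 :: r)) ?perm_cons // (perm_catCA [:: a] [:: a.+1]).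
    have -> : minn 'C(a + S + 2, 2) (a * a + q + 3 * (a + S) + 2) =
        expected_rank (a.+1 :: a :: r).
      by rewrite /expected_rank /twice_dim_cone (perm_sumn p2) (perm_sqsum p2).
    apply: (secant_rank_perm p2); apply: IHN.
    - by rewrite /=; lia.
    - rewrite /= leqnSn /=; apply/allP => x /mem_rem; exact: (allP ta).
    rewrite -[sqsum (a :: r)]/(a * a + sqsum r) /=.
    (* The new head is below the new tail sum unless the rest sums to at most 1; in these cases the
       second alternative holds. *)
    have [->|r0] := posnP (sumn r).
      by apply/orP; right; rewrite addn0; nia.
    case: (ltngtP (sumn r) 1) => [|r1|r1]; first by lia.
      by apply/orP; left; lia.
    by rewrite r1; apply/orP; right; have := sqsum_le_sq r; nia.
  have ta' : all (geq a) t.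
    apply/allP => x xt; have := allP ta x xt; rewrite /= leq_eqVlt => /orP[/eqP xa|//].
    by rewrite -xa xt in aI.
  apply: IHN => //; rewrite -/S -/q.
  by case/orP: good => [aS|->]; [rewrite (ltn_trans _ aS) | rewrite orbT].
have bin_step : 'C(a.+1 + S + 2, 2) = 'C(a + S + 2, 2) + (a + S + 2).
  by rewrite !addSn binS bin1.
have bin_a : 2 * 'C(a + S + 2, 2) = (a + S + 2) * (a + S + 1) by apply: bin2_double.
rewrite /expected_rank /twice_dim_cone -[sqsum (_ :: _)]/(a.+1 * a.+1 + q) /= -/S.
(* Restriction to the line can now fill all forms of degree a + S + 1, a space of dimension a + S +
   2. For S = a + 2 both terms of the minimum grow by this number; for smaller S the hypothesis
   makes the binomial the minimum before and after. *)
have [aS|aS] := leqP S a.+2.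
  have -> : minn 'C(a.+1 + S + 2, 2) (a.+1 * a.+1 + q + 3 * (a.+1 + S) + 2) =
      minn 'C(a + S + 2, 2) (a * a + q + 3 * (a + S) + 2) + (a + S + 2).
    have [eS|lt_S] := eqVneq S a.+2.
      rewrite bin_step [X in minn _ X](_ : _ = a * a + q + 3 * (a + S) + 2 + (a + S + 2)).
        by rewrite addn_minl.
      by rewrite eS; nia.
    have fill : S * S <= 3 * S + q by case/orP: good => // ; lia.
    rewrite !(minn_idPl _) //; first exact: (fill_condition a fill).
    exact: (fill_condition a.+1 fill).
  by apply: secant_rank_step rk; rewrite -/S; lia.
(* Not being irreducible means that the smaller space of forms has room for twice the dimension; the
   minimum then grows by 2 a + 4, all that the two factors contribute on the line. *)
have le2 : a * a + q + 3 * (a + S) + 2 <= 'C(a + S + 2, 2).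
  by move: red => /orP[|]; nia.
rewrite (minn_idPr le2) in rk.
rewrite (minn_idPr _); last by rewrite bin_step; nia.
rewrite (_ : a.+1 * a.+1 + q + 3 * (a.+1 + S) + 2 = a * a + q + 3 * (a + S) + 2 + (2 * a + 4)).
  by apply: secant_rank_step rk; rewrite -/S; lia.
by nia.
Qed.

End Induction.

Local Open Scope ring_scope.

(** * The sporadic types *)

(* (a, b, c) stands for a + b t + c t^2 in Z[t]/(t^3 - t - 1), whose reductions
   modulo 2 and 3 are the fields with 8 and 27 elements; over F_2 and F_3 there
   are too few lines for general position. *)
Definition cubic := (Z * Z * Z)%type.

Section CubicOperations.
Local Open Scope Z_scope.

Definition cub0 : cubic := (0, 0, 0).
Definition cub1 : cubic := (1, 0, 0).

Definition cub_add (x y : cubic) : cubic :=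
  let: (a, b, c) := x in let: (d, e, f) := y in (a + d, b + e, c + f).

(** [u] and [v] are the coefficients of t^3 = t + 1 and of t^4 = t^2 + t. *)
Definition cub_mul (x y : cubic) : cubic :=
  let: (a, b, c) := x in let: (d, e, f) := y in
  let u := b * f + c * e in let v := c * f in
  (a * d + u, a * e + b * d + u + v, a * f + b * e + c * d + v).

(** The product of the other two conjugates of [x], so that [x] times it is the norm. *)
Definition cub_adj (x : cubic) : cubic :=
  let: (a, b, c) := x in
  ((a + c) * (a + c) - b * (b + c), c * (b + c) - b * (a + c), b * b - c * (a + c)).

Definition cub_norm (x : cubic) : Z :=
  let: (a, b, c) := x in let: (d, e, f) := cub_adj x in a * d + c * e + b * f.

(** An element of norm 1 or -1 has nonzero image in every field, so one certificate serves all
    characteristics. *)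
Definition cub_is_unit (x : cubic) : bool := Z.eqb (Z.abs (cub_norm x)) 1.

Definition cub_scale_sub (n : Z) (x y z : cubic) : cubic :=
  let: (a, b, c) := x in let: (d, e, f) := cub_mul y z in
  (n * a - d, n * b - e, n * c - f).

Definition cub_is0 (x : cubic) : bool :=
  if x is (0, 0, 0) then true else false.

End CubicOperations.

Definition exponents := (nat * nat * nat)%type.
Definition cpoly := seq (exponents * cubic).

Definition term (a b c : nat) (u v w : Z) : exponents * cubic := ((a, b, c), (u, v, w)).

Definition exp_add (m m' : exponents) : exponents :=
  (m.1.1 + m'.1.1, m.1.2 + m'.1.2, m.2 + m'.2)%N.

Definition exp_deg (m : exponents) : nat := (m.1.1 + m.1.2 + m.2)%N.

Definition cpoly_mul (p q : cpoly) : cpoly :=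
  [seq (exp_add x.1 y.1, cub_mul x.2 y.2) | x <- p, y <- q].

Definition cpoly_prod (ps : seq cpoly) : cpoly :=
  foldr cpoly_mul [:: ((0, 0, 0)%N, cub1)] ps.

Definition cpoly_coef (p : cpoly) (m : exponents) : cubic :=
  foldr (fun x acc => if x.1 == m then cub_add x.2 acc else acc) cub0 p.

Definition exps_of_deg d : seq exponents :=
  flatten [seq [seq (a, b, d - a - b)%N | b <- iota 0 (d - a).+1] | a <- iota 0 d.+1].

Definition multiples_rows (cols : seq exponents) d (P : cpoly) : seq (seq cubic) :=
  [seq [seq cpoly_coef (cpoly_mul [:: (m, cub1)] P) c | c <- cols] | m <- exps_of_deg d].

Definition tangent_rows (cols : seq exponents) (lam : seq nat) (F : seq cpoly) :=
  flatten [seq multiples_rows cols (nth 0%N lam i)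
      (cpoly_prod [seq nth [::] F j | j <- iota 0 (size lam) & j != i])
    | i <- iota 0 (size lam)].

(* Gaussian elimination with prescribed unit pivots (row, column), the row being
   counted among those not yet used.  A row q is replaced by
   N q - q_c adj(p) r, where p = r_c is the pivot and N = p adj(p) its norm. *)
Fixpoint eliminate (n : nat) (rows : seq (seq cubic)) (pivots : seq (nat * nat)) : bool :=
  if pivots is (i, c) :: pivots' then
    let r := nth [::] rows i in
    let p := nth cub0 r c in
    let adj := cub_adj p in
    let N := cub_norm p in
    let reduce q :=
      let f := nth cub0 q c in
      if cub_is0 f then q else
      let g := cub_mul f adj in [seq cub_scale_sub N x.1 g x.2 | x <- zip q r] in
    if [&& i < size rows, c < n & cub_is_unit p]%N then
      eliminate n [seq reduce q | q <- take i rows ++ drop i.+1 rows] pivots'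
    else false
  else true.

Definition homogeneous_data (lam : seq nat) (F : seq cpoly) : bool :=
  (size F == size lam) &&
  all (fun i => all (fun x => exp_deg x.1 == nth 0%N lam i) (nth [::] F i)) (iota 0 (size lam)).

Record certificate := Certificate
  { cert_F : seq cpoly; cert_G : seq cpoly; cert_pivots : seq (nat * nat) }.

Definition certified (lam : seq nat) (C : certificate) : bool :=
  let cols := exps_of_deg (sumn lam) in
  [&& homogeneous_data lam (cert_F C), homogeneous_data lam (cert_G C) &
      eliminate (size cols)
        (tangent_rows cols lam (cert_F C) ++ tangent_rows cols lam (cert_G C))
        (cert_pivots C)].

(** * Soundness of the elimination over an arbitrary field *)

Section Soundness.
Variables (k : closedFieldType) (th : k).
Hypothesis thP : th ^+ 3 = th + 1.
Local Notation R := {mpoly k[3]}.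
Local Notation mon := 'X_{1..3}.

Definition Zval (z : Z) : k := (int_of_Z z)%:~R.

Lemma ZvalD a b : Zval (Z.add a b) = Zval a + Zval b.
Proof. by rewrite /Zval -[Z.add a b]/(a + b) !rmorphD. Qed.
Lemma ZvalN a : Zval (Z.opp a) = - Zval a.
Proof. by rewrite /Zval -[Z.opp a]/(- a) !rmorphN. Qed.
Lemma ZvalB a b : Zval (Z.sub a b) = Zval a - Zval b.
Proof. by rewrite -Z.add_opp_r ZvalD ZvalN. Qed.
Lemma ZvalM a b : Zval (Z.mul a b) = Zval a * Zval b.
Proof. by rewrite /Zval -[Z.mul a b]/(a * b) !rmorphM. Qed.
Definition ZvalE := (ZvalD, ZvalB, ZvalM).

Definition cval (x : cubic) : k :=
  let: (a, b, c) := x in Zval a + Zval b * th + Zval c * th ^+ 2.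

Lemma cval0 : cval cub0 = 0.
Proof. by rewrite /cval /Zval /= !mul0r !addr0. Qed.

Lemma cval1 : cval cub1 = 1.
Proof. by rewrite /cval /Zval /= !mul0r !addr0. Qed.

Lemma cvalD x y : cval (cub_add x y) = cval x + cval y.
Proof. by case: x => [[a b] c]; case: y => [[d e] f]; rewrite /= !ZvalE; ring. Qed.

Lemma cvalM x y : cval (cub_mul x y) = cval x * cval y.
Proof.
case: x => [[a b] c]; case: y => [[d e] f]; rewrite /= !ZvalE.
set A := Zval a; set B := Zval b; set C := Zval c.
set D := Zval d; set E := Zval e; set F := Zval f.
transitivity (A * D + (A * E + B * D) * th + (A * F + B * E + C * D) * th ^+ 2 +
  (B * F + C * E) * (th + 1) + C * F * (th + 1) * th); first by ring.
by rewrite -thP; ring.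
Qed.

Lemma cval_adj x : cval x * cval (cub_adj x) = Zval (cub_norm x).
Proof.
rewrite -cvalM; case: x => [[a b] c]; rewrite /= !ZvalE.
by ring.
Qed.

Lemma cval_scale_sub n x y z :
  cval (cub_scale_sub n x y z) = Zval n * cval x - cval y * cval z.
Proof.
rewrite -cvalM /cub_scale_sub; case: (cub_mul y z) => [[d e] f].
by case: x => [[a b] c]; rewrite /= !ZvalE; ring.
Qed.

Definition mon_of (m : exponents) : mon := [multinom [tuple m.1.1; m.1.2; m.2]].

Lemma mon_of_inj : injective mon_of.
Proof. by move=> [[a b] c] [[d e] f] [-> -> ->]. Qed.

Lemma mon_of_add m m' : mon_of (exp_add m m') = (mon_of m + mon_of m')%MM.
Proof.
by apply/mnmP; case=> [[|[|[|]]] //= i3]; rewrite mnmDE !multinomE !(tnth_nth 0%N).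
Qed.

Lemma mdeg_mon_of m : mdeg (mon_of m) = exp_deg m.
Proof.
by rewrite mdegE !big_ord_recl big_ord0 !multinomE !(tnth_nth 0%N) /= addn0 addnA.
Qed.

Definition pval (p : cpoly) : R := \sum_(x <- p) cval x.2 *: 'X_[mon_of x.1].

Lemma pvalM p q : pval (cpoly_mul p q) = pval p * pval q.
Proof.
rewrite /pval big_allpairs_dep mulr_suml; apply: eq_bigr => x _.
rewrite mulr_sumr; apply: eq_bigr => y _ /=.
by rewrite cvalM mon_of_add mpolyXD -scalerAl -scalerAr scalerA.
Qed.

Lemma pval_prod ps : pval (cpoly_prod ps) = \prod_(p <- ps) pval p.
Proof.
elim: ps => [|p ps IHps] /=; last by rewrite pvalM IHps big_cons.
rewrite big_nil /pval big_seq1 cval1 scale1r (_ : mon_of _ = 0%MM) ?mpolyX0 //.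
by apply/eqP; rewrite -mdeg_eq0 mdeg_mon_of.
Qed.

Lemma mcoeff_pval p m : (pval p)@_(mon_of m) = cval (cpoly_coef p m).
Proof.
rewrite /pval raddf_sum /=; elim: p => [|x p IHp]; first by rewrite big_nil cval0.
rewrite big_cons IHp mcoeffZ mcoeffX (inj_eq mon_of_inj) /=.
by case: eqP => _; rewrite ?cvalD ?mulr1 // mulr0 add0r.
Qed.

Lemma pval_homog d p : all (fun x => exp_deg x.1 == d) p -> pval p \is d.-homog.
Proof.
move=> /allP pd; rewrite /pval big_seq; apply: rpred_sum => x /pd xd.
by apply: rpredZ; rewrite dhomogX /= mdeg_mon_of.
Qed.

Variable cols : seq exponents.
Local Notation n := (size cols).
Local Notation col j := (mon_of (nth (0, 0, 0)%N cols j)).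

Definition represents (r : seq cubic) (p : R) :=
  size r = n /\ forall j, (j < n)%N -> cval (nth cub0 r j) = p@_(col j).

(** [V] stands for a linear space containing the rows. Each pivot replaces it by the subspace of
    forms with zero coefficient at the pivot column, so the chosen forms and columns give a
    triangular matrix and no row operation has to be recorded. *)
Lemma eliminate_sound (pivots : seq (nat * nat)) rows (V : R -> Prop) :
  V 0 -> (forall a b u v, V u -> V v -> V (a *: u - b *: v)) ->
  (forall r, r \in rows -> exists2 p, V p & represents r p) ->
  eliminate n rows pivots ->
  exists (vs : nat -> R) (ms : nat -> mon), (forall a, V (vs a)) /\
    \det (\matrix_(a < size pivots, c < size pivots) (vs a)@_(ms c)) != 0.
Proof.
elim: pivots rows V => [|[i c] pivots IH] rows V V0 Vlin rowsV /=.
  by move=> _; exists (fun=> 0), (fun=> 0%MM); split=> //; rewrite det_mx00 oner_neq0.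
set r := nth [::] rows i; set p := nth cub0 r c.
set reduce := fun q => _; set rest := map _ _.
case: ifP => [/and3P[ir cn /Z.eqb_eq N1] Nrest|//].
have Np : Zval (cub_norm p) != 0.
  by case: (cub_norm p) N1 => [|[]|[]] // _; rewrite /Zval /= ?oppr_eq0 oner_neq0.
have rV : r \in rows by rewrite mem_nth.
have [v Vv [sr vr]] := rowsV r rV.
have pv : v@_(col c) != 0.
  by rewrite -vr //; apply: contraNneq Np => p0; rewrite -cval_adj p0 mul0r.
pose V' w := V w /\ w@_(col c) = 0.
have restV q : q \in rest -> exists2 w, V' w & represents q w.
  case/mapP => q0 q0rows ->.
  have q0in : q0 \in rows.
    move: q0rows; rewrite mem_cat => /orP[/mem_take|/mem_drop] //.
  have [w Vw [sq wq]] := rowsV q0 q0in.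
  rewrite /reduce; case: ifP => [f0|_].
    exists w => //; split=> //; rewrite -wq //.
    by move: f0; case: (nth cub0 q0 c) => [[[] //[] //] [] //]; rewrite cval0.
  exists (Zval (cub_norm p) *: w - (cval (nth cub0 q0 c) * cval (cub_adj p)) *: v).
    split; first exact: Vlin.
    rewrite mcoeffB !mcoeffZ -wq // -vr // -/p -cval_adj; ring.
  split; first by rewrite size_map size_zip sq sr minnn.
  move=> j jn; rewrite (nth_map (cub0, cub0)) ?size_zip ?sq ?sr ?minnn //.
  rewrite nth_zip ?sq ?sr //= cval_scale_sub cvalM wq // vr //.
  by rewrite mcoeffB !mcoeffZ.
have V'0 : V' 0 by split; rewrite ?mcoeff0.
have V'lin a b u w : V' u -> V' w -> V' (a *: u - b *: w).
  move=> [Vu u0] [Vw w0]; split; first exact: Vlin.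
  by rewrite mcoeffB !mcoeffZ u0 w0 !mulr0 subr0.
have [vs [ms [V'vs det_vs]]] := IH rest V' V'0 V'lin restV Nrest.
exists (fun a => if a is a'.+1 then vs a' else v).
exists (fun a => if a is a'.+1 then ms a' else col c); split.
  by case=> [|a]; [exact: Vv | case: (V'vs a)].
rewrite (expand_det_col _ ord0) big_ord_recl big1 ?addr0 => [|a _]; last first.
  by rewrite mxE (V'vs _).2 mul0r.
rewrite mxE mulf_neq0 // /cofactor /= expr0 mul1r.
move: det_vs; congr (\det _ != 0); apply/matrixP => a b.
by rewrite !mxE.
Qed.

End Soundness.

Section Certification.
Variable k : closedFieldType.
Local Notation R := {mpoly k[3]}.

Lemma secant_rank_certified lam C :
  certified lam C -> secant_rank k lam (size (cert_pivots C)).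
Proof.
(* The generator t is sent to a root of t^3 - t - 1, which exists as [k] is algebraically closed. *)
have [th thP] : exists th : k, th ^+ 3 = th + 1.
  have [th thE] := @solve_monicpoly k 3 (fun i => (i < 2)%:R) isT.
  exists th; rewrite thE !big_ord_recl big_ord0 /= !mul1r mul0r !addr0 expr0 expr1.
  by rewrite addrC.
case/and3P => hF hG; set cols := exps_of_deg _; set I := 'I_(size lam).
pose deg (i : I) := nth 0%N lam i.
pose form (F : seq cpoly) (i : I) : R := pval th (nth [::] F i).
have formH F : homogeneous_data lam F -> forall i, form F i \is (deg i).-homog.
  case/andP => _ /allP hFi i; apply: pval_homog; apply: hFi.
  by rewrite mem_iota add0n /=.
pose TF F v := exists2 H : I -> R, (forall i, H i \is (deg i).-homog) & v = tang (form F) H.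
have rowsT F : homogeneous_data lam F -> forall r, r \in tangent_rows cols lam F ->
    exists2 p, TF F p & represents th cols r p.
  case/andP => /eqP sF _ r /flattenP[rs /mapP[i]]; rewrite mem_iota add0n leq0n.
  move=> il -> /mapP[m mdeg_m ->].
  pose i' : I := Ordinal il.
  have mh : ('X_[mon_of m] : R) \is (deg i').-homog.
    rewrite dhomogX /= mdeg_mon_of; case/flattenP: mdeg_m => ms /mapP[a].
    rewrite mem_iota add0n leq0n => ad -> /mapP[b]; rewrite mem_iota add0n leq0n => bd ->.
    move: ad bd; rewrite /= !ltnS /exp_deg /deg /= => ad bd; apply/eqP.
    by rewrite -addnA subnKC ?subnKC.
  exists (tang (form F) (at_index i' 'X_[mon_of m])).
    exists (at_index i' 'X_[mon_of m]) => // j; rewrite /at_index.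
    by case: eqP => [->|_]; [exact: mh | exact: dhomog0].
  rewrite tang_at_index; split; first by rewrite size_map.
  move=> j jn; rewrite (nth_map (0, 0, 0)%N) // -(mcoeff_pval th) (pvalM thP) (pval_prod thP).
  rewrite {1}/pval big_seq1 cval1 scale1r; congr ((_ * _)@__).
  rewrite big_map big_filter -[X in iota 0 X]subn0 -/(index_iota 0 (size lam)) big_mkord.
  by [].
pose V v := exists H K : I -> R, (forall i, H i \is (deg i).-homog /\ K i \is (deg i).-homog) /\
  v = tang (form (cert_F C)) H + 1 *: tang (form (cert_G C)) K.
have V0 : V 0.
  exists (fun=> 0), (fun=> 0); split; first by move=> i; split; apply: dhomog0.
  by rewrite !tang0 scaler0 addr0.
have tang_lin (F H H' : I -> R) a b :
    tang F (fun i => a *: H i - b *: H' i) = a *: tang F H - b *: tang F H'.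
  rewrite /tang !scaler_sumr -sumrB; apply: eq_bigr => i _.
  by rewrite mulrBl !scalerAl.
have Vlin a b u v : V u -> V v -> V (a *: u - b *: v).
  move=> [H [K [HKh ->]]] [H' [K' [HKh' ->]]].
  exists (fun i => a *: H i - b *: H' i), (fun i => a *: K i - b *: K' i); split.
    move=> i; have [Hh Kh] := HKh i; have [Hh' Kh'] := HKh' i.
    by split; apply: rpredB; apply: rpredZ.
  by rewrite !tang_lin !scale1r !scalerDr opprD addrACA.
move=> elim_ok.
have [|vs [ms [Vvs det_vs]]] := eliminate_sound thP V0 Vlin _ elim_ok.
  move=> r; rewrite mem_cat => /orP[/(rowsT _ hF)|/(rowsT _ hG)] [p [H Hh ->] rp].
    exists (tang (form (cert_F C)) H) => //; exists H, (fun=> 0); split.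
      by move=> i; split; [exact: Hh | exact: dhomog0].
    by rewrite tang0 scaler0 addr0.
  exists (tang (form (cert_G C)) H) => //; exists (fun=> 0), H; split.
    by move=> i; split; [exact: dhomog0 | exact: Hh].
  by rewrite tang0 scale1r add0r.
have [H HP] := fin_all_exists (fun a : 'I_(size (cert_pivots C)) => Vvs a).
have [K HKP] := fin_all_exists HP.
pose ext (L : 'I_(size (cert_pivots C)) -> I -> R) (a : nat) : I -> R :=
  if insub a is Some a' then L a' else fun=> 0.
exists (form (cert_F C)), (form (cert_G C)), (ext H), (ext K), ms; split.
- by move=> i; split; apply: formH.
- move=> a i; rewrite /ext; case: insubP => [a' _ _|_]; first exact: (HKP a').1.
  by split; apply: dhomog0.
move: det_vs; congr (\det _ != 0); apply/matrixP => a c; rewrite !mxE.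
by rewrite /ext !valK (HKP a).2.
Qed.

End Certification.

(** In the order of [sporadic]: the factors of F, those of G, and as many unit pivots as the
    expected rank. *)
Definition sporadic_certificates : seq certificate := [::
  Certificate
    [:: [:: term 0 1 0 0 1 0; term 0 0 1 0 1 0]; [:: term 1 0 0 0 1 0; term 0 1 0 0 0 1;
        term 0 0 1 1 1 0]; [:: term 0 0 1 (-1) 0 0; term 0 1 0 0 (-1) 0;
        term 1 0 0 1 0 0]; [:: term 0 1 0 0 (-1) 0]]
    [:: [:: term 1 0 0 0 0 1]; [:: term 1 0 0 (-1) 0 0; term 0 1 0 1 0 0];
        [:: term 0 0 1 (-1) 1 0]; [:: term 0 1 0 1 0 0; term 0 0 1 0 0 1;
        term 1 0 0 (-1) 0 0]]
    [:: (23, 12); (17, 9); (20, 6); (15, 5); (16, 10); (12, 1); (5, 11); (7, 7); (2, 13);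
        (12, 8); (12, 14); (0, 3); (1, 2); (1, 4); (3, 0)]%N;
  Certificate
    [:: [:: term 1 0 0 1 1 0]; [:: term 0 0 1 (-1) (-1) 0]; [:: term 1 0 0 (-1) 0 0;
        term 0 1 0 0 0 (-1); term 0 0 1 1 1 0]; [:: term 0 1 0 1 1 0];
        [:: term 0 0 1 (-1) 0 0; term 1 0 0 1 0 0]]
    [:: [:: term 0 0 1 0 0 (-1); term 1 0 0 (-1) (-1) 0]; [:: term 0 1 0 1 (-1) 0;
        term 0 0 1 0 (-1) 0; term 1 0 0 0 1 0]; [:: term 0 1 0 (-1) 0 0;
        term 0 0 1 0 1 0]; [:: term 0 0 1 0 (-1) 0; term 0 1 0 0 1 0;
        term 1 0 0 (-1) 1 0]; [:: term 1 0 0 (-1) 0 0; term 0 1 0 (-1) 0 0]]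
    [:: (6, 7); (6, 8); (3, 16); (10, 9); (9, 12); (6, 6); (3, 14); (3, 19); (1, 3);
        (4, 18); (10, 11); (15, 15); (0, 1); (7, 13); (11, 17); (8, 2); (9, 20); (4, 4);
        (7, 10); (4, 5); (7, 0)]%N;
  Certificate
    [:: [:: term 1 0 0 1 0 0]; [:: term 0 0 1 0 1 0]; [:: term 0 1 0 0 (-1) 0;
        term 0 0 1 1 0 0]; [:: term 0 0 1 (-1) (-1) 0; term 1 0 0 0 (-1) 0;
        term 0 1 0 0 1 0]; [:: term 0 0 1 (-1) (-1) 0; term 0 1 0 0 0 1];
        [:: term 1 0 0 0 1 0; term 0 0 1 0 1 0; term 0 1 0 (-1) (-1) 0]]
    [:: [:: term 0 0 1 0 0 (-1); term 0 1 0 1 0 0]; [:: term 0 1 0 0 (-1) 0];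
        [:: term 0 1 0 (-1) 0 0; term 0 0 1 (-1) (-1) 0; term 1 0 0 0 (-1) 0];
        [:: term 0 1 0 1 0 0; term 1 0 0 (-1) 0 0]; [:: term 0 1 0 0 0 1;
        term 1 0 0 0 1 0]; [:: term 0 0 1 (-1) (-1) 0; term 1 0 0 0 (-1) 0]]
    [:: (10, 8); (15, 14); (9, 7); (13, 13); (9, 18); (9, 19); (6, 20); (4, 12); (16, 3);
        (24, 5); (22, 15); (16, 9); (18, 17); (6, 22); (7, 23); (12, 24); (4, 21);
        (9, 26); (10, 25); (7, 4); (10, 2); (11, 16); (8, 11); (1, 1); (10, 6); (0, 0)]%N;
  Certificate
    [:: [:: term 2 0 0 0 0 (-1); term 0 0 2 0 1 0; term 1 0 1 (-1) 0 0];
        [:: term 0 1 0 (-1) (-1) 0; term 1 0 0 (-1) (-1) 0]; [:: term 1 0 0 0 0 1;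
        term 0 1 0 (-1) (-1) 0]; [:: term 1 0 0 (-1) (-1) 0]; [:: term 0 1 0 (-1) (-1) 0]]
    [:: [:: term 0 1 1 0 (-1) 0; term 0 2 0 1 0 0; term 1 0 1 1 (-1) 0];
        [:: term 0 0 1 0 0 (-1); term 1 0 0 1 1 0]; [:: term 1 0 0 (-1) 1 0;
        term 0 0 1 (-1) 1 0; term 0 1 0 (-1) 1 0]; [:: term 0 0 1 0 (-1) 0;
        term 0 1 0 1 0 0]; [:: term 0 0 1 1 1 0; term 0 1 0 (-1) (-1) 0]]
    [:: (4, 24); (2, 12); (2, 23); (0, 19); (0, 11); (0, 26); (7, 4); (6, 3); (3, 9);
        (0, 14); (5, 25); (0, 21); (2, 17); (4, 27); (8, 8); (11, 18); (8, 22); (15, 16);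
        (12, 13); (7, 7); (5, 1); (10, 10); (13, 15); (8, 2); (10, 20); (10, 5); (7, 6);
        (4, 0)]%N;
  Certificate
    [:: [:: term 0 1 1 0 1 0; term 1 1 0 (-1) 0 0]; [:: term 1 0 1 0 0 (-1)];
        [:: term 0 1 0 1 0 0; term 1 0 0 (-1) 0 0]; [:: term 0 0 1 (-1) 1 0]]
    [:: [:: term 1 0 1 0 0 (-1); term 0 2 0 (-1) (-1) 0; term 0 0 2 0 1 0];
        [:: term 0 2 0 0 (-1) 0; term 2 0 0 (-1) 1 0]; [:: term 1 0 0 0 0 1;
        term 0 0 1 0 1 0; term 0 1 0 0 0 (-1)]; [:: term 0 0 1 (-1) (-1) 0;
        term 1 0 0 1 1 0]]
    [:: (1, 9); (13, 19); (11, 8); (12, 15); (5, 2); (2, 18); (3, 22); (7, 23); (1, 10);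
        (7, 20); (0, 13); (16, 7); (1, 3); (6, 14); (11, 0); (8, 25); (6, 4); (13, 16);
        (9, 1); (1, 11); (13, 5); (12, 24); (11, 12); (6, 26); (8, 21); (7, 17); (8, 6);
        (6, 27)]%N;
  Certificate
    [:: [:: term 1 1 0 (-1) 0 0; term 2 0 0 1 0 0; term 0 1 1 1 0 0];
        [:: term 0 2 0 (-1) 0 0]; [:: term 2 0 0 (-1) 0 0]]
    [:: [:: term 1 0 1 (-1) 0 0; term 0 2 0 (-1) 0 0; term 0 1 1 1 0 0];
        [:: term 1 0 1 (-1) 0 0; term 0 0 2 1 0 0; term 2 0 0 1 0 0; term 0 2 0 (-1) 0 0];
        [:: term 0 1 1 (-1) 0 0; term 1 0 1 (-1) 0 0; term 2 0 0 1 0 0; term 0 0 2 1 0 0]]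
    [:: (2, 17); (2, 20); (2, 21); (2, 24); (6, 26); (4, 16); (0, 15); (9, 11); (8, 10);
        (5, 3); (2, 23); (4, 4); (3, 27); (2, 25); (2, 12); (11, 5); (16, 6); (5, 2);
        (17, 22); (12, 19); (1, 18); (10, 9); (13, 14); (5, 8); (11, 13); (4, 7); (8, 1);
        (2, 0)]%N;
  Certificate
    [:: [:: term 0 1 1 1 0 0; term 0 0 2 0 0 1]; [:: term 2 0 0 1 1 0;
        term 0 2 0 (-1) 0 0]; [:: term 2 0 0 0 0 (-1); term 0 0 2 (-1) (-1) 0];
        [:: term 1 0 0 (-1) (-1) 0; term 0 0 1 1 1 0]]
    [:: [:: term 2 0 0 1 (-1) 0]; [:: term 0 2 0 1 (-1) 0; term 2 0 0 (-1) 0 0;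
        term 1 1 0 0 0 (-1)]; [:: term 0 0 2 1 0 0; term 0 2 0 1 0 0];
        [:: term 0 1 0 0 (-1) 0]]
    [:: (32, 29); (28, 19); (27, 16); (27, 20); (36, 25); (36, 32); (25, 14); (26, 24);
        (33, 26); (24, 13); (23, 7); (22, 6); (26, 27); (25, 28); (25, 31); (25, 30);
        (25, 34); (21, 5); (17, 17); (4, 11); (1, 3); (14, 12); (11, 4); (1, 22);
        (13, 23); (10, 10); (7, 9); (5, 2); (8, 21); (9, 18); (4, 1); (0, 15); (3, 8);
        (0, 33); (0, 35); (0, 0)]%N;
  Certificate
    [:: [:: term 0 0 3 (-1) (-1) 0]; [:: term 2 1 0 0 (-1) 0; term 0 0 3 0 0 1;
        term 1 0 2 0 (-1) 0]; [:: term 0 1 0 0 0 (-1); term 1 0 0 0 1 0];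
        [:: term 0 0 1 (-1) (-1) 0; term 1 0 0 1 1 0]]
    [:: [:: term 1 0 2 (-1) (-1) 0; term 3 0 0 1 1 0; term 1 1 1 0 1 0];
        [:: term 0 3 0 0 0 1; term 3 0 0 (-1) 0 0; term 1 1 1 (-1) 1 0];
        [:: term 1 0 0 1 0 0; term 0 0 1 (-1) 0 0; term 0 1 0 1 (-1) 0];
        [:: term 0 1 0 0 (-1) 0]]
    [:: (15, 11); (15, 12); (11, 2); (10, 1); (20, 20); (15, 35); (11, 4); (11, 24);
        (11, 30); (1, 27); (5, 38); (13, 10); (3, 36); (12, 31); (12, 5); (3, 33); (6, 3);
        (4, 41); (3, 40); (1, 21); (21, 28); (16, 17); (5, 9); (21, 34); (18, 18);
        (15, 13); (17, 22); (17, 37); (9, 14); (14, 26); (11, 32); (9, 15); (12, 29);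
        (1, 19); (12, 25); (3, 0); (12, 43); (8, 23); (7, 16); (4, 6); (4, 7); (1, 39);
        (7, 42); (8, 44); (3, 8)]%N;
  Certificate
    [:: [:: term 0 1 2 (-1) 0 0]; [:: term 2 1 0 1 0 0; term 3 0 0 (-1) 0 0;
        term 0 0 3 (-1) 0 0]; [:: term 0 0 2 1 0 0; term 2 0 0 1 0 0]]
    [:: [:: term 1 0 2 (-1) 0 0; term 2 1 0 (-1) 0 0]; [:: term 0 3 0 1 0 0;
        term 0 0 3 (-1) 0 0]; [:: term 1 1 0 (-1) 0 0; term 0 2 0 1 0 0;
        term 2 0 0 1 0 0]]
    [:: (16, 12); (10, 1); (12, 4); (13, 11); (11, 3); (13, 19); (13, 36); (10, 2);
        (11, 18); (10, 10); (13, 25); (14, 32); (13, 27); (27, 30); (24, 21); (35, 29);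
        (32, 22); (15, 7); (11, 20); (21, 24); (4, 9); (30, 34); (10, 26); (13, 14);
        (27, 17); (4, 40); (10, 6); (19, 38); (3, 31); (13, 23); (3, 41); (12, 35);
        (4, 43); (17, 39); (14, 33); (4, 44); (10, 28); (2, 37); (0, 0); (1, 42); (6, 13);
        (2, 5); (4, 16); (3, 15); (2, 8)]%N;
  Certificate
    [:: [:: term 2 0 1 1 0 0]; [:: term 1 1 1 (-1) 0 0; term 0 2 1 (-1) 0 0;
        term 1 2 0 1 0 0; term 2 0 1 (-1) 0 0]; [:: term 0 3 0 1 0 0]]
    [:: [:: term 3 0 0 1 0 0; term 0 3 0 (-1) 0 0; term 1 1 1 1 0 0];
        [:: term 3 0 0 1 0 0; term 0 0 3 (-1) 0 0; term 2 0 1 (-1) 0 0];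
        [:: term 0 0 3 (-1) 0 0; term 0 3 0 (-1) 0 0; term 1 2 0 (-1) 0 0]]
    [:: (18, 38); (18, 43); (17, 37); (10, 22); (12, 25); (13, 31); (12, 30); (10, 23);
        (14, 36); (16, 41); (10, 24); (15, 42); (15, 45); (5, 16); (6, 32); (13, 46);
        (7, 39); (4, 15); (1, 6); (4, 33); (13, 3); (0, 5); (2, 26); (33, 51); (0, 7);
        (29, 48); (6, 49); (3, 35); (4, 40); (20, 47); (27, 52); (12, 27); (12, 11);
        (8, 28); (21, 13); (20, 4); (11, 17); (14, 21); (7, 10); (18, 50); (19, 54);
        (7, 12); (13, 44); (16, 53); (8, 20); (6, 2); (2, 34); (8, 29); (11, 14); (6, 8);
        (5, 19); (4, 1); (5, 18); (4, 9); (3, 0)]%N;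
  Certificate
    [:: [:: term 0 3 1 (-1) 0 0; term 0 4 0 1 0 0; term 2 1 1 (-1) 0 0];
        [:: term 0 0 3 1 0 0; term 2 1 0 1 0 0]; [:: term 0 0 3 (-1) 0 0]]
    [:: [:: term 4 0 0 1 0 0; term 1 3 0 1 0 0; term 0 4 0 (-1) 0 0; term 2 1 1 (-1) 0 0];
        [:: term 3 0 0 (-1) 0 0; term 0 2 1 (-1) 0 0; term 2 1 0 (-1) 0 0];
        [:: term 0 3 0 (-1) 0 0; term 2 0 1 1 0 0]]
    [:: (3, 3); (4, 11); (8, 22); (9, 30); (0, 0); (3, 12); (0, 1); (3, 14); (0, 2);
        (3, 23); (0, 4); (2, 31); (14, 5); (0, 13); (15, 15); (0, 21); (0, 38); (9, 46);
        (16, 50); (3, 7); (4, 32); (5, 39); (4, 16); (4, 25); (9, 53); (6, 29); (7, 37);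
        (2, 24); (6, 44); (1, 26); (3, 28); (1, 47); (2, 35); (3, 40); (9, 19); (11, 49);
        (19, 57); (5, 9); (15, 41); (17, 20); (9, 34); (14, 10); (7, 18); (2, 45);
        (14, 55); (8, 48); (4, 51); (16, 61); (3, 8); (8, 52); (4, 56); (7, 33); (3, 17);
        (5, 43); (2, 6); (6, 36); (6, 42); (7, 60); (4, 54); (2, 27); (4, 58); (4, 59);
        (2, 63); (3, 62); (4, 64); (4, 65)]%N;
  Certificate
    [:: [:: term 3 0 1 0 0 (-1); term 2 2 0 0 (-1) 0; term 0 2 2 1 1 0];
        [:: term 0 4 0 (-1) 0 0]; [:: term 0 0 1 (-1) 0 0]; [:: term 1 0 0 1 0 0]]
    [:: [:: term 0 0 4 0 0 (-1); term 0 4 0 (-1) 0 0; term 0 3 1 1 0 0];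
        [:: term 0 4 0 1 1 0; term 4 0 0 1 (-1) 0; term 2 1 1 (-1) 1 0];
        [:: term 1 0 0 0 0 (-1); term 0 1 0 (-1) (-1) 0; term 0 0 1 (-1) (-1) 0];
        [:: term 0 0 1 (-1) (-1) 0; term 1 0 0 0 0 1]]
    [:: (0, 15); (0, 16); (4, 26); (1, 18); (6, 35); (13, 41); (6, 36); (8, 49); (4, 28);
        (1, 19); (5, 43); (20, 37); (1, 25); (1, 27); (10, 48); (0, 17); (16, 44);
        (5, 42); (0, 34); (3, 40); (13, 6); (5, 47); (7, 53); (7, 56); (10, 7); (13, 24);
        (4, 46); (7, 60); (34, 33); (3, 45); (4, 52); (11, 31); (32, 50); (9, 8); (3, 51);
        (3, 57); (15, 62); (23, 13); (1, 38); (22, 29); (7, 32); (7, 58); (8, 39);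
        (15, 3); (22, 22); (5, 5); (4, 54); (22, 9); (8, 63); (17, 30); (18, 20);
        (19, 10); (6, 61); (1, 14); (15, 55); (15, 23); (10, 4); (11, 12); (10, 11);
        (4, 59); (4, 64); (7, 2); (6, 1); (6, 21); (4, 65); (4, 0)]%N;
  Certificate
    [:: [:: term 0 0 4 (-1) 0 0; term 1 3 0 1 0 0]; [:: term 0 0 4 1 0 0;
        term 3 0 1 1 0 0; term 0 4 0 1 0 0; term 3 1 0 1 0 0]; [:: term 0 1 1 1 0 0;
        term 0 2 0 (-1) 0 0; term 0 0 2 (-1) 0 0]]
    [:: [:: term 3 1 0 (-1) 0 0; term 4 0 0 1 0 0; term 1 2 1 (-1) 0 0; term 0 4 0 1 0 0];
        [:: term 1 1 2 1 0 0]; [:: term 2 0 0 1 0 0]]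
    [:: (42, 40); (43, 42); (42, 41); (47, 57); (39, 34); (44, 52); (50, 56); (43, 48);
        (39, 35); (37, 32); (39, 46); (40, 53); (38, 39); (57, 27); (36, 31); (37, 47);
        (36, 33); (53, 26); (52, 18); (44, 60); (36, 51); (28, 44); (47, 24); (47, 17);
        (27, 30); (14, 59); (13, 37); (41, 63); (25, 38); (33, 54); (37, 61); (22, 21);
        (9, 45); (19, 13); (34, 62); (32, 58); (7, 19); (20, 55); (20, 0); (17, 12);
        (6, 16); (15, 11); (16, 22); (20, 49); (7, 36); (18, 29); (14, 14); (8, 43);
        (21, 64); (15, 15); (17, 23); (5, 50); (6, 28); (16, 25); (5, 20); (15, 65);
        (11, 6); (10, 1); (1, 7); (1, 8); (1, 9); (1, 10); (1, 4); (3, 2); (1, 5);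
        (1, 3)]%N;
  Certificate
    [:: [:: term 5 0 0 1 0 0; term 0 0 5 1 0 0; term 2 0 3 (-1) 0 0];
        [:: term 0 2 3 (-1) 0 0]; [:: term 0 0 2 1 0 0; term 1 0 1 1 0 0;
        term 2 0 0 1 0 0]]
    [:: [:: term 0 4 1 1 0 0; term 0 5 0 (-1) 0 0; term 1 0 4 1 0 0; term 1 3 1 (-1) 0 0];
        [:: term 1 4 0 (-1) 0 0; term 4 0 1 (-1) 0 0]; [:: term 0 2 0 (-1) 0 0;
        term 1 0 1 (-1) 0 0]]
    [:: (0, 2); (0, 3); (41, 16); (11, 40); (14, 59); (39, 4); (6, 17); (0, 50); (5, 18);
        (0, 5); (9, 39); (6, 28); (3, 49); (8, 66); (32, 58); (12, 73); (17, 79);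
        (21, 84); (4, 38); (5, 27); (25, 15); (25, 65); (5, 57); (2, 48); (23, 72);
        (12, 78); (15, 83); (17, 87); (26, 63); (31, 71); (1, 7); (25, 64); (11, 80);
        (33, 81); (33, 62); (33, 69); (0, 6); (6, 74); (29, 77); (17, 56); (26, 45);
        (17, 21); (23, 42); (24, 76); (1, 51); (22, 44); (19, 33); (20, 35); (5, 75);
        (46, 52); (45, 34); (18, 43); (43, 31); (0, 19); (13, 55); (14, 23); (34, 53);
        (14, 24); (22, 37); (13, 22); (33, 70); (33, 20); (24, 46); (22, 41); (27, 67);
        (13, 54); (22, 47); (24, 32); (20, 30); (21, 60); (13, 25); (22, 61); (4, 13);
        (5, 36); (1, 0); (15, 29); (17, 68); (17, 82); (6, 86); (7, 89); (4, 26); (4, 85);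
        (3, 14); (5, 8); (3, 88); (3, 90); (3, 9); (1, 1); (2, 10); (2, 11); (2, 12)]%N;
  Certificate
    [:: [:: term 0 1 5 1 0 0; term 6 0 0 (-1) 0 0]; [:: term 0 6 0 (-1) 0 0;
        term 3 2 1 1 0 0; term 1 0 5 1 0 0; term 0 2 4 (-1) 0 0]; [:: term 0 2 0 1 0 0;
        term 2 0 0 1 0 0; term 1 1 0 (-1) 0 0]]
    [:: [:: term 0 0 6 1 0 0; term 2 1 3 (-1) 0 0; term 1 5 0 (-1) 0 0];
        [:: term 1 5 0 (-1) 0 0]; [:: term 0 0 2 1 0 0]]
    [:: (70, 35); (63, 21); (87, 89); (84, 72); (83, 71); (82, 70); (73, 47); (75, 50);
        (73, 48); (80, 81); (62, 20); (63, 23); (64, 25); (70, 49); (105, 40); (73, 61);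
        (66, 36); (105, 53); (71, 60); (78, 5); (65, 34); (67, 39); (64, 26); (75, 6);
        (66, 51); (65, 38); (64, 37); (65, 62); (64, 59); (63, 24); (62, 22); (78, 33);
        (90, 52); (89, 41); (67, 4); (62, 80); (65, 3); (86, 64); (69, 19); (73, 32);
        (74, 43); (76, 54); (67, 17); (64, 2); (76, 65); (64, 15); (75, 66); (11, 27);
        (30, 95); (30, 7); (61, 16); (60, 1); (59, 0); (64, 42); (61, 29); (10, 57);
        (63, 69); (61, 31); (33, 101); (60, 44); (62, 75); (61, 56); (57, 18); (58, 30);
        (58, 55); (4, 12); (39, 104); (34, 109); (41, 113); (3, 11); (34, 106); (36, 110);
        (3, 13); (31, 97); (26, 8); (24, 93); (28, 102); (29, 107); (37, 119); (11, 63);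
        (10, 88); (28, 111); (24, 99); (26, 90); (27, 114); (1, 9); (30, 84); (1, 10);
        (26, 116); (27, 118); (9, 94); (19, 67); (20, 100); (20, 105); (9, 76); (2, 77);
        (2, 78); (18, 115); (2, 46); (18, 96); (3, 85); (3, 87); (4, 73); (11, 92);
        (13, 117); (4, 74); (10, 98); (10, 112); (2, 28); (0, 82); (3, 79); (1, 108);
        (3, 86); (6, 58); (2, 83); (2, 91); (4, 68); (4, 103); (1, 45); (0, 14)]%N].

Lemma secant_rank_sporadic (k : closedFieldType) e :
  e \in sporadic -> secant_rank k e (expected_rank e).
Proof.
pose C e := nth (Certificate [::] [::] [::]) sporadic_certificates (index e sporadic).
have check : all (fun e => certified e (C e) && (size (cert_pivots (C e)) == expected_rank e))
    sporadic by vm_compute.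
by case/(allP check)/andP => cert /eqP<-; apply: secant_rank_certified.
Qed.

Local Close Scope ring_scope.

(** * The defective types *)

(** Raising a part e by one adds binomial (e + 3) 2 - binomial (e + 2) 2 = e + 2, which the
    multiples of a single cofactor already provide on the line. This gives the exact dimension of
    the cone over X. *)
Lemma tangent_rank_cone (k : closedFieldType) b (I : finType) (lam : I -> nat) : 0 < #|I| ->
  tangent_rank k b lam (\sum_i 'C(lam i + 2, 2).-1).+1.
Proof.
move=> I0; have [N] := ubnP (\sum_i lam i); elim: N lam => // N IHN lam.
rewrite ltnS => leN; have [all0|[i0 li0]] : (forall i, lam i = 0) \/ exists i, 0 < lam i.
  have [/forallP all0|/forallPn[i li]] := boolP [forall i, lam i == 0]; [left|right].
    by move=> i; apply/eqP.
  by exists i; rewrite lt0n.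
  rewrite big1 => [|i _]; last by rewrite all0.
  exact: tangent_rank0.
pose lam' i := if i == i0 then (lam i0).-1 else lam i.
have lam'0 : lam' i0 = (lam i0).-1 by rewrite /lam' eqxx.
have lam'N i : i != i0 -> lam' i = lam i by move=> ni; rewrite /lam' (negbTE ni).
have sum' (f : nat -> nat) : \sum_(i | i != i0) f (lam' i) = \sum_(i | i != i0) f (lam i).
  by apply: eq_bigr => i /lam'N ->.
have le' : \sum_i lam' i < N.
  apply: leq_trans leN; rewrite (bigD1 i0) // [X in _ <= X](bigD1 i0) //=.
  by rewrite (sum' id) lam'0 -addSn prednK.
have -> : (\sum_i 'C(lam i + 2, 2).-1).+1 = (\sum_i 'C(lam' i + 2, 2).-1).+1 + (lam' i0).+2.
  rewrite (bigD1 i0) // [X in _ = X.+1 + _](bigD1 i0) //= (sum' (fun l => 'C(l + 2, 2).-1)).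
  rewrite lam'0; case: (lam i0) li0 => // l _ /=.
  have C0 : 0 < 'C(l + 2, 2) by rewrite bin_gt0 leq_addl.
  by rewrite addSn binS bin1; lia.
apply: (@tangent_rank_step k b I i0 lam') (IHN _ le').
- by rewrite lam'0 prednK.
- by move=> i /lam'N.
case: (b) => //; apply/andP; split; last by lia.
by rewrite !ltnS (bigD1 i0) //= leq_addr.
Qed.

(** Algebraic independence on [S] is not decided by an algorithm, so the largest size below the
    bound is found by classical case analysis. *)
Lemma has_dim_exists (k : closedFieldType) (S : {mpoly k[3]} -> Prop) ms0 u :
  alg_indep_on S ms0 -> (forall ms, alg_indep_on S ms -> size ms <= u) ->
  exists2 n, has_dim S n & n <= u.
Proof.
move=> indep0; elim: u => [|u IHu] bound.
  exists 0 => //; split=> //; exists ms0 => //.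
  by have := bound _ indep0; case: size.
have [[ms sz indep]|noms] := classic (exists2 ms, size ms = u.+1 & alg_indep_on S ms).
  by exists u.+1 => //; split=> //; exists ms.
have [ms indep|n dimn nu] := IHu; last by exists n => //; apply: leqW.
have := bound ms indep; rewrite leq_eqVlt => /orP[/eqP sz|//].
by case: noms; exists ms.
Qed.

(** Translates 2 p > 3 s into S^2 > 3 S + q, the form in which the induction meets it. *)
Lemma sqsum_pairsum t : sumn t * sumn t = sqsum t + 2 * pairsum t.
Proof.
elim: t => [|x t IHt]; first by rewrite /pairsum big_ord0.
have sumE : \sum_(j < size t) nth 0 t j = sumn t.
  by rewrite sumnE (big_nth 0) big_mkord.
have -> : pairsum (x :: t) = x * sumn t + pairsum t.
  rewrite /pairsum big_ord_recl /=; congr (_ + _).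
    by rewrite big_mkcond big_ord_recl /= add0n -sumE big_distrr.
  apply: eq_bigr => i _; rewrite big_mkcond big_ord_recl /= add0n [RHS]big_mkcond.
  by apply: eq_bigr.
rewrite /sqsum /= -/(sqsum t); move: IHt; nia.
Qed.

Lemma twice_sum_bin2 t :
  2 * \sum_(i < size t) 'C(nth 0 t i + 2, 2).-1 = sqsum t + 3 * sumn t.
Proof.
rewrite /sqsum; elim: t => [|x t IHt]; first by rewrite big_ord0.
rewrite big_ord_recl /= mulnDr IHt.
have : 0 < 'C(x + 2, 2) by rewrite bin_gt0 leq_addl.
by have := bin2_double x; nia.
Qed.

Theorem theorem3p1 (k : closedFieldType) (lam : seq nat) :
  (2 <= size lam)%N -> sorted geq lam -> all (fun e => 0 < e)%N lam ->
  sec2_defective k lam <->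
  (sumn (behead lam) <= head 0%N lam /\
   3 * sumn (behead lam) < 2 * pairsum (behead lam))%N.
Proof.
case: lam => [|a t] //= _ lam_s /andP[a0 _].
have ta : all (geq a) t.
  by apply: order_path_min lam_s => ? ? ? /[swap]; apply: leq_trans.
have d0 : 0 < sumn (a :: t) by rewrite /= addn_gt0 a0.
set x := 'C(a + 2, 2) + \sum_(i < size t) 'C(nth 0 t i + 2, 2).-1.
have xE : 2 * x = twice_dim_cone (a :: t).
  rewrite mulnDr twice_sum_bin2 bin2_double /twice_dim_cone -[sqsum (_ :: _)]/(a * a + sqsum t) /=.
  by nia.
have dimX_le ms : alg_indep_on (@Xcone k (a :: t)) ms -> size ms <= x.
  exact: Xcone_dim_le.
have pE := sqsum_pairsum t.
split=> [[dX [dS [[[msX <- indepX] _] [_ boundS] lt_dS]]]|[le_a lt_p]].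
  have [|good] := boolP ((sumn t <= a) && (3 * sumn t < 2 * pairsum t)).
    by move/andP.
  have {}good : (a < sumn t) || (sumn t * sumn t <= 3 * sumn t + sqsum t).
    by move: good; rewrite negb_and -ltnNge -leqNgt => /orP[->|]//; lia.
  have [ms sz /boundS] := tangent_rank_alg_indep d0
    (secant_rank_expected (@secant_rank_sporadic k) ta good).
  rewrite sz leqNgt; case/negP; apply: leq_trans lt_dS _.
  by rewrite /expected_rank -xE leq_min geq_minl /= geq_min leq_mul2l dimX_le ?orbT.
have rank b : tangent_rank k b (fun i : 'I_(size (a :: t)) => nth 0 (a :: t) i) x.
  have := @tangent_rank_cone k b _ (fun i : 'I_(size (a :: t)) => nth 0 (a :: t) i).
  rewrite card_ord big_ord_recl /= -addSn prednK ?bin_gt0 ?leq_addl //; exact.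
have [msX szX indepX] := tangent_rank_alg_indep d0 (rank false).
have [msS szS indepS] := tangent_rank_alg_indep d0 (rank true).
(* The independent family [indepS] only ensures that a dimension exists; its value is controlled by
   the parameter count. *)
have [dS dimS leS] := has_dim_exists indepS (fun ms => @sec2cone_dim_le k a t ms le_a).
exists x, dS; split=> //; first by split=> //; exists msX.
apply: leq_ltn_trans leS _; rewrite leq_min.
have [n aE] : exists n, a = sumn t + n by exists (a - sumn t); rewrite subnKC.
have := bin2_double a; have := bin2_double (a + sumn t); have := bin2_double (a - sumn t).
have := twice_sum_bin2 t; rewrite /x /=.
have : 0 < 'C(a - sumn t + 2, 2) by rewrite bin_gt0 leq_addl.
have : 'C(a - sumn t + 2, 2) <= 'C(a + 2, 2) by rewrite leq_bin2l ?leq_add2r ?leq_subr.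
set s := \sum_(_ < _) _; set A := 'C(a + 2, 2); set N := 'C(a - _ + 2, 2).
set D := 'C(_ + _ + 2, 2) => leNA N0 sE ND DD AD.
(* The count is 2 x - N with N >= 1, hence below 2 x, and it equals D - (2 p - 3 s), hence is below
   D. *)
apply/andP; split; last by lia.
have {}ND : 2 * N = (n + 2) * (n + 1) by rewrite ND aE addKn.
rewrite aE in AD DD; nia.
Qed.
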